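(* Let $m\ge 0$ and $k\in\mathbf{R}$ with $|k|<\sqrt{3}/2$. Then for every nonzero real number $k_0$ the unique self-adjoint extension in $\mathcal{H}_A^2$, again denoted $H_{DC}|_{\mathcal{H}_A^2}$, of the operator $$H_{DC}=H\otimes I_4+I_4\otimes H+\frac{k_0}{|\mathbf{r}_1-\mathbf{r}_2|}I_{16},\qquad H=\vec{\alpha}\cdot\vec{p}+m\beta-\frac{k}{|\mathbf{r}|}I_4,$$ defined on $[C_0^\infty(\mathbf{R}^3;\mathbf{C}^4)]^{\otimes 2}\cap\mathcal{H}_A^2$, satisfies $$\sigma_{ess}\big(H_{DC}|_{\mathcal{H}_A^2}\big)=\mathbf{R}.$$
   Context: Let $\vec p=-i\nabla$ on $\mathbf{R}^3$, let $\sigma_1=\begin{pmatrix}0&1\\ 1&0\end{pmatrix}$, $\sigma_2=\begin{pmatrix}0&-i\\ i&0\end{pmatrix}$, $\sigma_3=\begin{pmatrix}1&0\\ 0&-1\end{pmatrix}$ be the Pauli matrices, and let $\alpha_j=\begin{pmatrix}0&\sigma_j\\ \sigma_j&0\end{pmatrix}$ $(j=1,2,3)$, $\beta=\begin{pmatrix}I_2&0\\ 0&-I_2\end{pmatrix}$ be the $4\times4$ Dirac matrices; $\vec\alpha\cdot\vec p=\sum_{j=1}^3\alpha_jp_j$. Let $\mathcal{H}=L^2(\mathbf{R}^3;\mathbf{C}^4)$. The tensor product $\mathcal{H}\otimes\mathcal{H}$ is identified with $L^2(\mathbf{R}^6;\mathbf{C}^{16})$, whose elements are written $\psi(\mathbf{r}_1,\mathbf{r}_2)={}^t(\vec\psi_{11},\vec\psi_{12},\vec\psi_{21},\vec\psi_{22})$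 with $\vec\psi_{ab}\in L^2(\mathbf{R}^6;\mathbf{C}^4)$: if $\psi={}^t(\psi_1,\psi_2)$ and $\psi'={}^t(\psi_1',\psi_2')$ are in $\mathcal{H}$, with upper and lower parts $\psi_a={}^t(\psi_{a1},\psi_{a2})$, $\psi'_b={}^t(\psi'_{b1},\psi'_{b2})\in L^2(\mathbf{R}^3;\mathbf{C}^2)$, then the $(a,b)$ block of $\psi\otimes\psi'$ is ${}^t\big(\psi_{a1}(\mathbf r_1)\psi'_{b1}(\mathbf r_2),\ \psi_{a1}(\mathbf r_1)\psi'_{b2}(\mathbf r_2),\ \psi_{a2}(\mathbf r_1)\psi'_{b1}(\mathbf r_2),\ \psi_{a2}(\mathbf r_1)\psi'_{b2}(\mathbf r_2)\big)$. The operator $H\otimes I_4$ (resp. $I_4\otimes H$) is $H$ acting on the first (resp. second) factor. For $\vec a={}^t(a_1,a_2,a_3,a_4)\in\mathbf{C}^4$ put $Mat[\vec a]=\begin{pmatrix}a_1&a_3\\ a_2&a_4\end{pmatrix}$, and write $\psi_{ab}=Mat[\vec\psi_{ab}]$. The antisymmetric subspace is $$\mathcal{H}_A^2=\{\psi\in L^2(\mathbf{R}^6;\mathbf{C}^{16}) : \psi_{aa}(\mathbf r_2,\mathbf r_1)=-{}^t\psi_{aa}(\mathbf r_1,\mathbf r_2)\ (a=1,2),\ \psi_{12}(\mathbf r_2,\mathbf r_1)=-{}^t\psi_{21}(\mathbf r_1,\mathbf r_2)\},$$ with the $L^2$ inner product, i.e. the usual antisymmetric tensor product $\mathcal{H}\otimes_A\mathcal{H}$.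 $[C_0^\infty(\mathbf{R}^3;\mathbf{C}^4)]^{\otimes2}$ denotes the algebraic tensor product of $C_0^\infty(\mathbf{R}^3;\mathbf{C}^4)$ with itself, regarded as a subspace of $L^2(\mathbf{R}^6;\mathbf{C}^{16})$. Under the stated hypotheses the operator on this domain is (by a separate result of the paper) essentially self-adjoint in $\mathcal{H}_A^2$, so the unique self-adjoint extension is its closure. *)

(* Defs.v *)
From HB Require Import structures.
From mathcomp Require Import all_boot all_order all_algebra.
From mathcomp Require Import complex.
From mathcomp Require Import all_classical all_reals all_analysis.

Set Implicit Arguments.
Unset Strict Implicit.
Unset Printing Implicit Defensive.

Import Order.TTheory GRing.Theory Num.Theory.
Import numFieldNormedType.Exports.

Local Open Scope classical_set_scope.
Local Open Scope ring_scope.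
Local Open Scope complex_scope.

(* The canonical sigma-finite structure of m1 \x m2 in the library is keyed on
   subprobabilities only, so it cannot be inferred for Lebesgue measure. *)
Lemma product_measure_sigma_finite d1 d2 (T1 : measurableType d1)
    (T2 : measurableType d2) (R : realType)
    (m1 : {sigma_finite_measure set T1 -> \bar R})
    (m2 : {sigma_finite_measure set T2 -> \bar R}) :
  sigma_finite setT (m1 \x m2)%E.
Proof.
have /sigma_finiteP[F [TF ndF Foo]] := sigma_finiteT m1.
have /sigma_finiteP[G [TG ndG Goo]] := sigma_finiteT m2.
exists (fun n => F n `*` G n).
  rewrite -setXTT TF TG predeqE => -[x y]; split.
    move=> [/= [n _ Fnx] [k _ Gky]]; exists (maxn n k) => //; split.
    - by move: x Fnx; exact/subsetPset/ndF/leq_maxl.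
    - by move: y Gky; exact/subsetPset/ndG/leq_maxr.
  by move=> [n _ []/= ? ?]; split; exists n.
move=> k; have [? ?] := Foo k; have [? ?] := Goo k.
split; first exact: measurableX.
by rewrite product_measure1E// lte_mul_pinfty// ge0_fin_numE.
Qed.

Section LebesgueMeasure.
Variable R : realType.
Local Notation mR := (measurableTypeR R).

Definition leb2 : set (mR * mR) -> \bar R :=
  (@lebesgue_measure R \x @lebesgue_measure R)%E.
HB.instance Definition _ := Measure.on leb2.
HB.instance Definition _ := Measure_isSigmaFinite.Build _ _ _ leb2
  (product_measure_sigma_finite _ _).

Definition leb3 : set (mR * mR * mR) -> \bar R :=
  (leb2 \x @lebesgue_measure R)%E.
HB.instance Definition _ := Measure.on leb3.
HB.instance Definition _ := Measure_isSigmaFinite.Build _ _ _ leb3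
  (product_measure_sigma_finite _ _).

Definition leb6 : set (mR * mR * mR * (mR * mR * mR)) -> \bar R :=
  (leb3 \x leb3)%E.
HB.instance Definition _ := Measure.on leb6.
HB.instance Definition _ := Measure_isSigmaFinite.Build _ _ _ leb6
  (product_measure_sigma_finite _ _).

End LebesgueMeasure.
Arguments leb2 {R}.
Arguments leb3 {R}.
Arguments leb6 {R}.

Notation R3 R := (R * R * R)%type.
Notation R6 R := (R3 R * R3 R)%type.
(* C^16 as C^4 (+) C^4 (+) C^4 (+) C^4, in the order 11, 12, 21, 22. *)
Notation C16 R := 'cV[R[i]]_((4 + 4) + (4 + 4)).
(* Representatives of elements of L^2(R^6; C^16); two of them denote the same
   element when they are equal almost everywhere. *)
Notation wavefun R := (R6 R -> C16 R).

Section DiracOperator.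
Variable R : realType.
Local Notation C := R[i].

Definition mx2 (a b c d : C) : 'M[C]_2 :=
  \matrix_(i, j) (if i == 0 then if j == 0 then a else b
                  else if j == 0 then c else d).

Definition pauli (j : 'I_3) : 'M[C]_2 :=
  [:: mx2 0 1 1 0; mx2 0 (- 'i%C) 'i%C 0; mx2 1 0 0 (- 1)]`_j.

Definition dirac_alpha (j : 'I_3) : 'M[C]_(2 + 2) :=
  block_mx 0 (pauli j) (pauli j) 0.

Definition dirac_beta : 'M[C]_(2 + 2) := block_mx 1%:M 0 0 (- 1%:M).

Definition basis3 (j : 'I_3) : R3 R :=
  ((val j == 0%N)%:R, (val j == 1%N)%:R, (val j == 2%N)%:R).

(* The canonical norm of the product type is the sup norm. *)
Definition euclid (r : R3 R) : R :=
  Num.sqrt (r.1.1 ^+ 2 + r.1.2 ^+ 2 + r.2 ^+ 2).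

Definition momentum (j : 'I_3) (f : R3 R -> 'cV[C]_4) (r : R3 R) : 'cV[C]_4 :=
  \col_i (- 'i%C * ('D_(basis3 j) (fun s => complex.Re (f s i 0)) r
                  +i* 'D_(basis3 j) (fun s => complex.Im (f s i 0)) r)).

Definition dirac_op (m k : R) (f : R3 R -> 'cV[C]_4) (r : R3 R) : 'cV[C]_4 :=
  \sum_(j < 3) dirac_alpha j *m momentum j f r
  + m%:C *: (dirac_beta *m f r)
  - (k / euclid r)%:C *: f r.

Definition iter_partial (s : seq 'I_3) (g : R3 R -> R) : R3 R -> R :=
  foldr (fun j h => 'D_(basis3 j) h) g s.

Definition smooth (g : R3 R -> R) : Prop := forall s : seq 'I_3,
  continuous (iter_partial s g) /\
  forall j r, derivable (iter_partial s g) r (basis3 j).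

Definition test_function (f : R3 R -> 'cV[C]_4) : Prop :=
  (forall i, smooth (fun r => complex.Re (f r i 0)) /\
             smooth (fun r => complex.Im (f r i 0))) /\
  compact (closure [set r | f r != 0]).

Definition kron2 (u v : 'cV[C]_2) : 'cV[C]_(2 + 2) :=
  col_mx (u 0 0 *: v) (u 1 0 *: v).

Definition kron4 (u v : 'cV[C]_(2 + 2)) : C16 R :=
  col_mx (col_mx (kron2 (usubmx u) (usubmx v)) (kron2 (usubmx u) (dsubmx v)))
         (col_mx (kron2 (dsubmx u) (usubmx v)) (kron2 (dsubmx u) (dsubmx v))).

Definition tensor (f g : R3 R -> 'cV[C]_4) : wavefun R :=
  fun x => kron4 (f x.1) (g x.2).

Definition Mat (a : 'cV[C]_4) : 'M[C]_2 :=
  mx2 (a (inord 0) 0) (a (inord 2) 0) (a (inord 1) 0) (a (inord 3) 0).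

Definition blk11 (v : C16 R) : 'cV[C]_4 := usubmx (usubmx v).
Definition blk12 (v : C16 R) : 'cV[C]_4 := dsubmx (usubmx v).
Definition blk21 (v : C16 R) : 'cV[C]_4 := usubmx (dsubmx v).
Definition blk22 (v : C16 R) : 'cV[C]_4 := dsubmx (dsubmx v).

Definition square_integrable (psi : wavefun R) : Prop := forall i,
  (fun x => complex.Re (psi x i 0)) \in Lfun leb6 2%:E /\
  (fun x => complex.Im (psi x i 0)) \in Lfun leb6 2%:E.

Definition exchange_antisymmetric (psi : wavefun R) : Prop :=
  {ae leb6, forall x : R6 R, let x' := (x.2, x.1) in
    [/\ Mat (blk11 (psi x')) = - (Mat (blk11 (psi x)))^T,
        Mat (blk22 (psi x')) = - (Mat (blk22 (psi x)))^T &
        Mat (blk12 (psi x')) = - (Mat (blk21 (psi x)))^T]}.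

Definition HA2 : set (wavefun R) :=
  [set psi | square_integrable psi /\ exchange_antisymmetric psi].

(* Graph of H_DC on the algebraic tensor product of the test functions with
   itself, intersected with HA2: H (x) I + I (x) H sends sum_j f_j (x) g_j to
   sum_j (H f_j) (x) g_j + f_j (x) (H g_j). *)
Definition H_DC (m k k0 : R) : set (wavefun R * wavefun R) :=
  [set p | HA2 p.1 /\
    exists (n : nat) (f g : 'I_n -> R3 R -> 'cV[C]_4),
      [/\ forall j, test_function (f j) /\ test_function (g j),
          p.1 = (fun x => \sum_(j < n) tensor (f j) (g j) x) &
          p.2 = (fun x =>
            \sum_(j < n) (tensor (dirac_op m k (f j)) (g j) x
                          + tensor (f j) (dirac_op m k (g j)) x)
            + (k0 / euclid (x.1 - x.2))%:C *: p.1 x)]].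

End DiracOperator.
Arguments HA2 {R}.

(* Operators in a closed subspace H of L^2(R^6; C^16) are given by their graphs,
   as sets of pairs of representatives. *)
Section Operators.
Variable R : realType.
Local Notation C := R[i].
Local Notation F := (wavefun R).
Implicit Types (H : set F) (T : set (F * F)) (u v w : F) (z : C).

Definition ae_equal u v : Prop := {ae leb6, forall x, u x = v x}.

Definition cintegral (h : R6 R -> C) : C :=
  (\int[leb6]_x complex.Re (h x)) +i* (\int[leb6]_x complex.Im (h x)).

Definition inner u v : C :=
  \sum_i cintegral (fun x => ((u x i 0)^*)%C * v x i 0).

Definition L2norm u : R := Num.sqrt (complex.Re (inner u u)).

Definition linear_operator H T : Prop :=
  [/\ T `<=` H `*` H,
      forall z u v u' v', T (u, v) -> T (u', v') ->
        T (z *: u + u', z *: v + v'),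
      forall u v u' v', T (u, v) -> H u' -> H v' ->
        ae_equal u u' -> ae_equal v v' -> T (u', v') &
      forall u v v', T (u, v) -> T (u, v') -> ae_equal v v'].

Definition densely_defined H T : Prop :=
  forall w, H w -> forall e : R, 0 < e ->
    exists u v, T (u, v) /\ L2norm (w - u) < e.

Definition adjoint H T : set (F * F) :=
  [set p | [/\ H p.1, H p.2 &
    forall u v, T (u, v) -> inner v p.1 = inner u p.2]].

Definition self_adjoint H T : Prop :=
  [/\ linear_operator H T, densely_defined H T & adjoint H T = T].

(* T - z is a bijection onto H with bounded inverse; the bound gives
   injectivity. *)
Definition resolvent_set H T : set C :=
  [set z |
    (forall w, H w -> exists u v, T (u, v) /\ ae_equal (v - z *: u) w) /\
    exists M : R, forall u v, T (u, v) -> L2norm u <= M * L2norm (v - z *: u)].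

Definition spectrum H T : set C := ~` resolvent_set H T.

(* R[i] carries no canonical topology, so isolation is stated with the norm. *)
Definition isolated_in (A : set C) z : Prop :=
  A z /\ exists e : R, 0 < e /\ forall z', A z' -> `|z' - z| < e%:C -> z' = z.

Definition eigenspace T z : set F :=
  [set u | exists v, T (u, v) /\ ae_equal v (z *: u)].

Definition eigenvalue T z : Prop :=
  exists u, eigenspace T z u /\ ~ ae_equal u 0.

Definition finite_multiplicity T z : Prop :=
  exists (n : nat) (b : 'I_n -> F), (forall j, eigenspace T z (b j)) /\
    forall u, eigenspace T z u ->
      exists c : 'I_n -> C, ae_equal u (\sum_(j < n) c j *: b j).

Definition discrete_spectrum H T : set C :=
  [set z | [/\ isolated_in (spectrum H T) z, eigenvalue T z &
               finite_multiplicity T z]].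

Definition essential_spectrum H T : set C :=
  spectrum H T `\` discrete_spectrum H T.

End Operators.

(* Main.v *)
(* A self-adjoint operator has real spectrum: in the complete space H_A^2 the
   range of T - z is closed for nonreal z, and a vector orthogonal to it is an
   eigenvector of T for the conjugate of z, hence zero.

   Conversely every real l is in the spectrum. Write l = E1 + E2 with
   |E1|, |E2| > m, so that the free Dirac operator has plane waves of energies E1
   and E2. Cut them off at scale nu, with centres at distance of order nu from
   the nucleus and on opposite sides of it. The Slater determinant of the two
   packets satisfies (H_DC - l) psi = O(1 / nu) pointwise on a box of side of
   order nu, since the derivatives of the cut-off and the three Coulomb
   potentials are O(1 / nu) there, whereas |psi| is bounded below on a box of
   comparable volume. So no bound |u| <= M |(T - l) u| can hold.

   The spectrum being R, it has no isolated point, and the discrete spectrum is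
   empty. *)

Require Import Defs.
From mathcomp Require Import all_boot all_order all_algebra.
From mathcomp Require Import complex ring lra.
From mathcomp Require Import all_classical all_reals all_analysis.
From mathcomp Require Import measurable_realfun.

Set Implicit Arguments.
Unset Strict Implicit.
Unset Printing Implicit Defensive.

Import Order.TTheory GRing.Theory Num.Theory.
Import numFieldNormedType.Exports ComplexField.Normc.

Local Open Scope classical_set_scope.
Local Open Scope ring_scope.
Local Open Scope complex_scope.

(** * Completeness of real L^2 *)

(** The operator [T] is known only through its self-adjointness and the inclusion of the graph of
    [H_DC]. A pair is thus shown to lie in [T] either by exhibiting test functions or by the
    equality of [T] with its adjoint; using the latter for limits is what calls for completeness of
    [HA2] and a projection theorem.

    Failure of a bounded inverse at every real point already excludes isolated points, so the
    packets are neither normalised nor made to converge weakly. Their norms are never computed: sup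
    bounds times volumes suffice, since all boxes involved have a volume proportional to [nu ^+ 6],
    which cancels and leaves the squared residual of relative size O([nu ^- 2]).

    Two particles reach energies that one cannot: with [E1] large and positive and [E2] negative,
    every [l] is a sum of energies outside the mass gap. A single bump on [1, 2], rescaled by a
    signed [nu], places both packets, and the same inequality on first coordinates keeps each away
    from the nucleus and from the other one, hence from all Coulomb singularities. *)

Section square_integrable_functions.
Context d (T : measurableType d) (R : realType).
Variable mu : {measure set T -> \bar R}.
Implicit Types f g : T -> R.

Lemma Lfun2P f : f \in Lfun mu 2%:E <->
  measurable_fun setT f /\ mu.-integrable setT (EFin \o (fun x => f x ^+ 2)).
Proof.
split=> [f2|[mf intf]].
  split; last exact: Lfun2_integrable_sqr.
  by have := sub_Lfun_mfun f2; rewrite inE.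
rewrite inE; apply/andP; split; rewrite inE//=.
rewrite /finite_norm unlock /= poweR_lty//.
have /integrableP[_] := intf; apply: le_lt_trans.
rewrite le_eqVlt; apply/orP; left; apply/eqP.
apply: eq_integral => x _ /=.
by rewrite powR_mulrn// normrX.
Qed.

Lemma Lfun2_linear a f g : f \in Lfun mu 2%:E -> g \in Lfun mu 2%:E ->
  (fun x => a * f x + g x) \in Lfun mu 2%:E.
Proof.
have le12 : (1 <= 2%:E :> \bar R)%E by rewrite lee_fin ler1n.
by move=> f2 g2; apply: (Lfun_submod_closed mu le12).2.
Qed.

Lemma Lfun2_integrableM f g : f \in Lfun mu 2%:E -> g \in Lfun mu 2%:E ->
  mu.-integrable setT (EFin \o (fun x => f x * g x)).
Proof. by move=> f2 g2; apply/Lfun1_integrable/Lfun2_mul_Lfun1. Qed.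

Lemma Lfun2_dominated f g : measurable_fun setT f -> g \in Lfun mu 2%:E ->
  (forall x, `|f x| <= `|g x|) -> f \in Lfun mu 2%:E.
Proof.
move=> mf /Lfun2P[_ g2] fg; apply/Lfun2P; split => //.
apply: le_integrable g2 => //.
  by apply/measurable_EFinP; exact: measurable_funX.
by move=> x _ /=; rewrite lee_fin !normrX lerXn2r// nnegrE.
Qed.

Lemma Lfun2_ae_eq0 f : f \in Lfun mu 2%:E -> \int[mu]_x (f x ^+ 2) = 0 ->
  {ae mu, forall x, f x = 0}.
Proof.
move=> /[dup] /Lfun2P[mf _] /Lfun2_integrable_sqr if2 if0.
have : (\int[mu]_x `|(f x ^+ 2)%:E| = 0)%E.
  rewrite -[RHS]/(0%:E) -if0 /Rintegral fineK ?integrable_fin_num//.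
  by apply: eq_integral => x _; rewrite gee0_abs// lee_fin sqr_ge0.
move/ae_eq_integral_abs => /(_ measurableT) h.
have /h : measurable_fun setT (fun x => (f x ^+ 2)%:E).
  by apply/measurable_EFinP; exact: measurable_funX.
by apply: filterS => x /(_ I)/= [/eqP]; rewrite sqrf_eq0 => /eqP.
Qed.

Lemma limn_einf_le (u : (\bar R)^nat) (c : \bar R) :
  (forall n, (u n <= c)%E) -> (limn_einf u <= c)%E.
Proof.
move=> uc; rewrite limn_einf_lim; apply: lime_le; first exact: is_cvg_einfs.
apply: nearW => n; apply: le_trans (uc n).
by apply: ereal_inf_lbound; exists n => /=.
Qed.

(* A subsequence with [\sum_k 2 ^ k * |f_(k.+1) - f_k| ^ 2] integrable converges
   pointwise, because [d <= 2 ^- k + 2 ^ k * d ^ 2]. *)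
Lemma Lfun2_complete (f : nat -> T -> R) :
  (forall n, f n \in Lfun mu 2%:E) ->
  (forall e, 0 < e -> exists N, forall n m, (N <= n)%N -> (N <= m)%N ->
    \int[mu]_x ((f n x - f m x) ^+ 2) < e) ->
  exists2 g, g \in Lfun mu 2%:E &
    forall e, 0 < e -> exists N, forall n, (N <= n)%N ->
      \int[mu]_x ((f n x - g x) ^+ 2) <= e.
Proof.
move=> f2 cf.
have fB n m : (fun x => f n x - f m x) \in Lfun mu 2%:E.
  have -> : (fun x => f n x - f m x) = (fun x => (-1) * f m x + f n x).
    by apply/funext => x; rewrite mulN1r addrC.
  exact: Lfun2_linear.
have ifB n m : (\int[mu]_x ((f n x - f m x) ^+ 2)%:E =
    (\int[mu]_x ((f n x - f m x) ^+ 2))%:E)%E.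
  by rewrite fineK// integrable_fin_num// (Lfun2_integrable_sqr (fB _ _)).
have e0 k : 0 < (4 ^- k : R) by rewrite invr_gt0 exprn_gt0.
have /choice[N NP] : forall k, exists N, forall n m, (N <= n)%N -> (N <= m)%N ->
    \int[mu]_x ((f n x - f m x) ^+ 2) < 4 ^- k by move=> k; exact: cf.
(* A sum rather than [N k] itself, so that [phi k] dominates every [N j] with [j <= k]. *)
pose phi k := (\sum_(j < k.+1) N j)%N.
have phi_ge j k : (j <= k)%N -> (N j <= phi k)%N.
  by move=> jk; rewrite /phi (bigD1 (Ordinal (jk : (j < k.+1)%N)))//= leq_addr.
pose D k x := 2 ^+ k * (f (phi k.+1) x - f (phi k) x) ^+ 2.
have D0 k x : 0 <= D k x by rewrite mulr_ge0 ?sqr_ge0// exprn_ge0.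
have mf n : measurable_fun setT (f n) by have /Lfun2P[] := f2 n.
have mD k : measurable_fun setT (D k).
  apply: measurable_funM => //; apply: measurable_funX.
  exact: measurable_funB.
pose S x : \bar R := (\sum_(k <oo) (D k x)%:E)%E.
have mS : measurable_fun setT S.
  apply: (@ge0_emeasurable_sum _ _ _ setT (fun k x => (D k x)%:E) predT) => //.
  - by move=> k x _ _; rewrite lee_fin.
  - by move=> k _; exact/measurable_EFinP.
have S0 x : (0 <= S x)%E by apply: nneseries_ge0 => n _ _; rewrite lee_fin.
have intS : (\int[mu]_x S x < +oo)%E.
  rewrite integral_nneseries//; last 2 first.
  - by move=> n; exact/measurable_EFinP.
  - by move=> n x _; rewrite lee_fin.
  (* The integral of [D k] is at most 2 ^ k times 4 ^- k; the bound 2 ^- k is written in the shape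
     of the geometric series summed below. *)
  apply: (@le_lt_trans _ _ (\sum_(k <oo) (2 / (2 ^ (k + 1))%:R)%:E)%E).
    apply: lee_nneseries => [k _ _|k _].
      by apply: integral_ge0 => x _; rewrite lee_fin.
    rewrite /D; under eq_integral do rewrite EFinM.
    rewrite ge0_integralZl_EFin ?exprn_ge0//; last 2 first.
    - by move=> x _; rewrite lee_fin sqr_ge0.
    - by apply/measurable_EFinP/measurable_funX; exact: measurable_funB.
    rewrite ifB -EFinM lee_fin.
    have -> : 2 / (2 ^ (k + 1))%:R = 2 ^+ k * 4 ^- k :> R.
      rewrite natrX exprD expr1 invfM mulrCA mulfV// mulr1.
      have -> : (4 : R) = 2 * 2 by rewrite -natrM.
      by rewrite exprMn invfM mulrA mulfV ?mul1r// expf_neq0.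
    rewrite ler_pM2l ?exprn_gt0//; apply: ltW; apply: NP; exact: phi_ge.
  have /cvg_lim := @cvg_geometric_eseries_half R 2 0.
  by rewrite /eseries /= => ->//; rewrite ltry.
pose A := [set x | (S x < +oo)%E].
have mA : measurable A.
  rewrite -[A]setTI; apply: measurable_lte => //.
have A_ae : {ae mu, forall x, A x}.
  have : mu.-integrable setT S.
    apply/integrableP; split => //.
    by under eq_integral do rewrite gee0_abs//.
  move/(integrable_ae measurableT); apply: filterS => x /(_ I).
  by rewrite ge0_fin_numE.
(* Set to 0 off the full-measure set [A], the subsequence converges at every point, which makes its
   limit measurable. *)
pose g k : T -> R := f (phi k) \_ A.
have mg k : measurable_fun setT (g k).
  by apply/(measurable_restrictT _ mA); exact: measurable_funS (mf _).
have cg x : cvgn (g ^~ x).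
  have [Ax|nAx] := pselect (A x); last first.
    have -> : g ^~ x = fun=> 0 by apply/funext => k; rewrite /g /patch memNset.
    exact: is_cvg_cst.
  have -> : g ^~ x = fun k => f (phi k) x.
    by apply/funext => k; rewrite /g /patch mem_set.
  suff : cvgn (series (telescope (fun k => f (phi k) x))).
    rewrite telescopeK => /cvg_ex[l /= hl]; apply/cvg_ex; exists (l + f (phi 0) x).
    have -> : (fun k => f (phi k) x) =
        (fun k => (f (phi k) x - f (phi 0) x) + f (phi 0) x).
      by apply/funext => k; rewrite subrK.
    by apply: cvgD => //; exact: cvg_cst.
  apply: normed_cvg.
  apply: (@series_le_cvg _ _ (fun k => geometric 1 2^-1 k + D k x)) => [k|k|k|].
  - exact: normr_ge0.
  - by rewrite addr_ge0// mulr_ge0// exprn_ge0.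
  - rewrite /telescope /D /=; set t := (_ - _); rewrite mul1r exprVn.
    have q0 : 0 < (2 : R) ^+ k by rewrite exprn_gt0.
    have [t1|t1] := leP `|t| (2 ^- k); first by rewrite ler_wpDr// mulr_ge0 ?sqr_ge0// ltW.
    rewrite -(ger0_norm (sqr_ge0 t)) normrX expr2 mulrA.
    rewrite ler_wpDl ?invr_ge0 ?(ltW q0)// ler_peMl//.
    by rewrite -ler_pdivrMl// mulr1; exact: ltW.
  - have -> : series (fun k => geometric 1 2^-1 k + D k x) =
        series (geometric 1 2^-1) + series (D ^~ x).
      by apply/funext => n; rewrite /series /= big_split.
    apply: is_cvgD.
      by apply: is_cvg_geometric_series; rewrite ger0_norm ?invr_ge0// invf_lt1// ltr1n.
    by apply: nnseries_is_cvg.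
pose G x : R := limn (g ^~ x).
have gG x : g ^~ x @ \oo --> G x by exact: cg.
have mG : measurable_fun setT G by apply: (measurable_fun_cvg mg) => x _; exact: gG.
(* Fatou's lemma for fixed [n]; the subsequence is shifted by [j] because the bound holds only from
   that index on. *)
have fG n e j : (forall k, (j <= k)%N -> \int[mu]_x ((f n x - f (phi k) x) ^+ 2) <= e) ->
    (\int[mu]_x ((f n x - G x) ^+ 2)%:E <= e%:E)%E.
  move=> He.
  have -> : (\int[mu]_x ((f n x - G x) ^+ 2)%:E =
     \int[mu]_x limn_einf (fun k => ((f n x - g (k + j)%N x) ^+ 2)%:E))%E.
    apply: eq_integral => x _; apply/esym.
    suff /cvg_limn_einf_sup[-> _] : ((f n x - g (k + j)%N x) ^+ 2)%:E @[k --> \oo] -->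
        ((f n x - G x) ^+ 2)%:E by [].
    apply: cvg_EFin; first exact: nearW.
    rewrite /comp /=.
    have h : f n x - g (k + j)%N x @[k --> \oo] --> f n x - G x.
      apply: cvgB; first exact: cvg_cst.
      by have := gG x; rewrite -(cvg_shiftn j).
    by under eq_fun do rewrite expr2; rewrite expr2; exact: cvgM.
  apply: le_trans (fatou _ _ _ _) _ => //.
  - move=> k; apply/measurable_EFinP/measurable_funX; exact: measurable_funB.
  - by move=> k x _; rewrite lee_fin sqr_ge0.
  apply: limn_einf_le => k.
  apply: (@le_trans _ _ (\int[mu]_x ((f n x - f (phi (k + j)) x) ^+ 2)%:E)%E); last first.
    by rewrite ifB lee_fin He// leq_addl.
  rewrite le_eqVlt; apply/orP; left; apply/eqP; apply: ae_eq_integral => //.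
  - by apply/measurable_EFinP/measurable_funX; exact: measurable_funB.
  - by apply/measurable_EFinP/measurable_funX; exact: measurable_funB.
  apply: filterS A_ae => x Ax _.
  by rewrite /g /patch mem_set.
have fG2 n e j : (forall k, (j <= k)%N -> \int[mu]_x ((f n x - f (phi k) x) ^+ 2) <= e) ->
   (fun x => f n x - G x) \in Lfun mu 2%:E.
  move=> /fG H; apply/Lfun2P; split; first exact: measurable_funB.
  apply/integrableP; split.
    by apply/measurable_EFinP/measurable_funX; exact: measurable_funB.
  apply: le_lt_trans (ltry e); apply: le_trans H.
  by under eq_integral do rewrite /= ger0_norm ?sqr_ge0//.
have Hj j n : (N j <= n)%N ->
    forall k, (j <= k)%N -> \int[mu]_x ((f n x - f (phi k) x) ^+ 2) <= 4 ^- j.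
  by move=> Nn k jk; apply/ltW/NP => //; exact: phi_ge.
exists G.
  have := fG2 _ _ _ (Hj 0%N _ (leqnn _)).
  move=> /(Lfun2_linear (-1)) /(_ (f2 (N 0%N))).
  have -> // : (fun x => -1 * (f (N 0%N) x - G x) + f (N 0%N) x) = G.
  by apply/funext => x; rewrite mulN1r opprB subrK.
move=> e e_gt0.
have [j je] : exists j, 4 ^- j <= e.
  have : (4^-1 : R) ^+ n @[n --> \oo] --> 0.
    by apply: cvg_expr; rewrite ger0_norm ?invr_ge0// invf_lt1// ltr1n.
  move=> /cvgr_le /(_ _ e_gt0)[j _ /(_ j (leqnn _))] /=.
  by rewrite exprVn; exists j.
exists (N j) => n Nn.
have H := fG _ _ _ (Hj _ _ Nn).
rewrite -lee_fin fineK; first by apply: le_trans H _; rewrite lee_fin.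
by rewrite integrable_fin_num// (Lfun2_integrable_sqr (fG2 _ _ _ (Hj _ _ Nn))).
Qed.

End square_integrable_functions.

(** * The Hilbert space of wave functions *)

(* Wave functions are typed over [R6 R], without its measurable structure, which
   hides the library's instance. *)
#[local] Instance ae_leb6_filter (R : realType) : Filter (nbhs (almost_everywhere (@leb6 R))).
Proof. exact: ae_filter_ringOfSetsType. Qed.

Section wave_functions.
Variable R : realType.
Local Notation C := R[i].
Local Notation F := (wavefun R).
Local Notation Re := (@complex.Re R).
Local Notation Im := (@complex.Im R).
Implicit Types (u v w : F) (a : R) (z : C).

Lemma ReD (x y : C) : Re (x + y) = Re x + Re y. Proof. by case: x y => ? ? []. Qed.
Lemma ImD (x y : C) : Im (x + y) = Im x + Im y. Proof. by case: x y => ? ? []. Qed.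
Lemma ReN (x : C) : Re (- x) = - Re x. Proof. by case: x. Qed.
Lemma ImN (x : C) : Im (- x) = - Im x. Proof. by case: x. Qed.
Lemma ReM (x y : C) : Re (x * y) = Re x * Re y - Im x * Im y.
Proof. by case: x y => ? ? []. Qed.
Lemma ImM (x y : C) : Im (x * y) = Re x * Im y + Im x * Re y.
Proof. by case: x y => ? ? []. Qed.
Lemma ReJ (x : C) : Re (x^*)%C = Re x. Proof. by case: x. Qed.
Lemma ImJ (x : C) : Im (x^*)%C = - Im x. Proof. by case: x. Qed.
Lemma Re_sum I (r : seq I) (G : I -> C) : Re (\sum_(i <- r) G i) = \sum_(i <- r) Re (G i).
Proof. exact: (big_morph Re ReD). Qed.
Lemma Im_sum I (r : seq I) (G : I -> C) : Im (\sum_(i <- r) G i) = \sum_(i <- r) Im (G i).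
Proof. exact: (big_morph Im ImD). Qed.

Lemma square_integrable_linear z u v : square_integrable u ->
  square_integrable v -> square_integrable (z *: u + v).
Proof.
move=> u2 v2 i; have [ru iu] := u2 i; have [rv iv] := v2 i; split.
- have -> : (fun x => Re ((z *: u + v) x i 0)) =
    (fun x => (- Im z) * Im (u x i 0) + (Re z * Re (u x i 0) + Re (v x i 0))).
    by apply/funext => x; rewrite !mxE ReD ReM; ring.
  exact/Lfun2_linear/Lfun2_linear.
- have -> : (fun x => Im ((z *: u + v) x i 0)) =
    (fun x => Im z * Re (u x i 0) + (Re z * Im (u x i 0) + Im (v x i 0))).
    by apply/funext => x; rewrite !mxE ImD ImM; ring.
  exact/Lfun2_linear/Lfun2_linear.
Qed.

(** Estimates and orthogonality are carried out in this real inner product; rotating the first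
    argument by ['i%C] recovers the imaginary part of [inner]. *)
Definition rinner u v : R := Re (inner u v).

Lemma rinnerE u v : rinner u v = \sum_i \int[leb6]_x
  (Re (u x i 0) * Re (v x i 0) + Im (u x i 0) * Im (v x i 0)).
Proof.
rewrite /rinner /inner Re_sum; apply: eq_bigr => i _ /=.
by apply: eq_Rintegral => x _; rewrite ReM ReJ ImJ; ring.
Qed.

Lemma Im_inner u v : Im (inner u v) = rinner ('i%C *: u) v.
Proof.
rewrite /rinner /inner Re_sum Im_sum; apply: eq_bigr => i _ /=.
by apply: eq_Rintegral => x _; rewrite !mxE !(ReM, ImM, ReJ, ImJ)/=; ring.
Qed.

Lemma inner_eq u v u' v' : rinner u v = rinner u' v' ->
  rinner ('i%C *: u) v = rinner ('i%C *: u') v' -> inner u v = inner u' v'.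
Proof. by move=> h1 h2; apply/eqP; rewrite eq_complex !Im_inner h2 -/(rinner u v) h1 !eqxx. Qed.

Lemma rinnerC u v : rinner u v = rinner v u.
Proof.
by rewrite !rinnerE; apply: eq_bigr => i _; apply: eq_Rintegral => x _; ring.
Qed.

Lemma rinnerZ z u v : rinner (z *: u) v = rinner u ((z^*)%C *: v).
Proof.
rewrite !rinnerE; apply: eq_bigr => i _; apply: eq_Rintegral => x _.
by rewrite !mxE !(ReM, ImM, ReJ, ImJ); ring.
Qed.

Lemma integrable_rinner u v i : square_integrable u -> square_integrable v ->
  leb6.-integrable setT (EFin \o (fun x =>
    Re (u x i 0) * Re (v x i 0) + Im (u x i 0) * Im (v x i 0))).
Proof.
move=> u2 v2; have [ru iu] := u2 i; have [rv iv] := v2 i.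
have -> : EFin \o (fun x =>
    Re (u x i 0) * Re (v x i 0) + Im (u x i 0) * Im (v x i 0)) =
  (EFin \o (fun x => Re (u x i 0) * Re (v x i 0))) \+
  (EFin \o (fun x => Im (u x i 0) * Im (v x i 0))) by apply/funext.
by apply: integrableD => //; exact: Lfun2_integrableM.
Qed.

Lemma rinner_linearl a u v w : square_integrable u -> square_integrable v ->
  square_integrable w -> rinner (a%:C *: u + v) w = a * rinner u w + rinner v w.
Proof.
move=> u2 v2 w2; rewrite !rinnerE mulr_sumr -big_split; apply: eq_bigr => i _ /=.
have iuw := integrable_rinner i u2 w2; have ivw := integrable_rinner i v2 w2.
rewrite -RintegralZl// -RintegralD//; last first.
  have := integrableZl measurableT a iuw.
  by congr (integrable _ _ _); apply/funext.
by apply: eq_Rintegral => x _; rewrite !mxE !(ReD, ImD, ReM, ImM)/=; ring.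
Qed.

Lemma rinner_ge0 u : 0 <= rinner u u.
Proof.
rewrite rinnerE sumr_ge0// => i _; apply: Rintegral_ge0 => x _.
by rewrite -!expr2 addr_ge0 ?sqr_ge0.
Qed.

Lemma rinner_norm_component u i : square_integrable u ->
  \int[leb6]_x (Re (u x i 0) ^+ 2) <= rinner u u /\
  \int[leb6]_x (Im (u x i 0) ^+ 2) <= rinner u u.
Proof.
move=> u2; have [ru iu] := u2 i.
have -> : rinner u u = \sum_j (\int[leb6]_x (Re (u x j 0) ^+ 2) +
                               \int[leb6]_x (Im (u x j 0) ^+ 2)).
  rewrite rinnerE; apply: eq_bigr => j _; have [rj ij] := u2 j.
  rewrite -RintegralD//; last 2 first.
  - exact: Lfun2_integrable_sqr rj.
  - exact: Lfun2_integrable_sqr ij.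
rewrite (bigD1 i)//=.
have h (P : pred _) : 0 <= \sum_(j | P j) (\int[leb6]_x (Re (u x j 0) ^+ 2) +
                               \int[leb6]_x (Im (u x j 0) ^+ 2)).
  by apply: sumr_ge0 => j _; rewrite addr_ge0//; apply: Rintegral_ge0 => x _; exact: sqr_ge0.
have r0 : 0 <= \int[leb6]_x (Re (u x i 0) ^+ 2).
  by apply: Rintegral_ge0 => x _; exact: sqr_ge0.
have i0 : 0 <= \int[leb6]_x (Im (u x i 0) ^+ 2).
  by apply: Rintegral_ge0 => x _; exact: sqr_ge0.
have s0 := h (fun j => j != i).
by split; [rewrite -addrA lerDl addr_ge0 | rewrite -addrA addrCA lerDl addr_ge0].
Qed.

Lemma rinner_eq0 u : square_integrable u -> rinner u u = 0 -> ae_equal u 0.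
Proof.
move=> u2 u0.
have H i : {ae leb6, forall x, u x i 0 = 0}.
  have [ru iu] := u2 i; have [] := rinner_norm_component i u2; rewrite u0 => hr hi.
  have r0 : \int[leb6]_x (Re (u x i 0) ^+ 2) = 0.
    by apply/eqP; rewrite eq_le hr; apply: Rintegral_ge0 => x _; exact: sqr_ge0.
  have i0 : \int[leb6]_x (Im (u x i 0) ^+ 2) = 0.
    by apply/eqP; rewrite eq_le hi; apply: Rintegral_ge0 => x _; exact: sqr_ge0.
  have aer : {ae leb6, forall x : R6 R, Re (u x i 0) = 0} := Lfun2_ae_eq0 ru r0.
  have aei : {ae leb6, forall x : R6 R, Im (u x i 0) = 0} := Lfun2_ae_eq0 iu i0.
  apply: filterS2 aer aei => x rx ix.
  by apply/eqP; rewrite eq_complex rx ix !eqxx.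
have : {ae leb6, forall x, forall i, u x i 0 = 0} by exact: filter_forall.
by apply: filterS => x ux; apply/colP => i; rewrite ux mxE.
Qed.

Lemma L2normE u : L2norm u = Num.sqrt (rinner u u). Proof. by []. Qed.

Lemma L2norm_ge0 u : 0 <= L2norm u. Proof. exact: sqrtr_ge0. Qed.

Lemma L2norm_sqr u : L2norm u ^+ 2 = rinner u u.
Proof. by rewrite L2normE sqr_sqrtr// rinner_ge0. Qed.

Lemma L2norm_linear_sqr a u v : square_integrable u -> square_integrable v ->
  L2norm (a%:C *: u + v) ^+ 2 =
  a ^+ 2 * L2norm u ^+ 2 + 2 * a * rinner u v + L2norm v ^+ 2.
Proof.
move=> u2 v2; rewrite !L2norm_sqr.
have uv2 := square_integrable_linear a%:C u2 v2.
rewrite rinner_linearl// rinnerC rinner_linearl// [in X in _ + X]rinnerC.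
by rewrite rinner_linearl// [rinner v u]rinnerC; ring.
Qed.

Lemma L2normZ z u : square_integrable u -> L2norm (z *: u) ^+ 2 = (Re z ^+ 2 + Im z ^+ 2) * L2norm u ^+ 2.
Proof.
move=> u2; rewrite !L2norm_sqr rinnerZ scalerA.
have -> : (z^*)%C * z = (Re z ^+ 2 + Im z ^+ 2)%:C.
  by case: z => p q; apply/eqP; rewrite eq_complex /=; apply/andP; split; apply/eqP; ring.
rewrite rinnerC.
have := rinner_linearl (Re z ^+ 2 + Im z ^+ 2) u2.
rewrite rinnerE rinnerE mulr_sumr; move=> _; apply: eq_bigr => i _.
rewrite -RintegralZl//; last exact: integrable_rinner.
by apply: eq_Rintegral => x _; rewrite !mxE !(ReM, ImM)/=; ring.
Qed.

Lemma rinner_CauchySchwarz u v : square_integrable u -> square_integrable v ->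
  `|rinner u v| <= L2norm u * L2norm v.
Proof.
move=> u2 v2.
rewrite -ler_sqr ?nnegrE ?mulr_ge0 ?L2norm_ge0// real_normK ?num_real// exprMn.
have H a : 0 <= a ^+ 2 * L2norm u ^+ 2 + 2 * a * rinner u v + L2norm v ^+ 2.
  by rewrite -L2norm_linear_sqr// sqr_ge0.
set X := L2norm u ^+ 2 in H *; set Y := L2norm v ^+ 2 in H *.
set r := rinner u v in H *.
have Y0 : 0 <= Y by exact: sqr_ge0.
have X0 : 0 <= X by exact: sqr_ge0.
have [XE|XN] := eqVneq X 0.
  have [->|r0] := eqVneq r 0; first by rewrite XE mul0r expr0n.
  (* For [X = 0] the nonnegative polynomial is affine with slope [2 * r]; at this point it would be
     -1. *)
  have := H (- (Y + 1) / (2 * r)); rewrite XE mulr0 add0r.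
  have -> : 2 * (- (Y + 1) / (2 * r)) * r + Y = - 1 by field.
  by rewrite oppr_ge0 ler10.
(* The minimiser of the quadratic polynomial. *)
have := H (- r / X).
have -> : (- r / X) ^+ 2 * X + 2 * (- r / X) * r + Y = (X * Y - r ^+ 2) / X by field.
have Xp : 0 < X by rewrite lt_neqAle eq_sym XN.
by rewrite pmulr_lge0 ?invr_gt0// subr_ge0.
Qed.

Lemma L2normD u v : square_integrable u -> square_integrable v ->
  L2norm (u + v) <= L2norm u + L2norm v.
Proof.
move=> u2 v2; rewrite -ler_sqr ?nnegrE ?addr_ge0 ?L2norm_ge0//.
rewrite -[u in u + v](scale1r u) (_ : 1 = 1%:C)// L2norm_linear_sqr//.
have := rinner_CauchySchwarz u2 v2; have := ler_norm (rinner u v); nra.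
Qed.

Lemma L2norm_distrC u v : L2norm (u - v) = L2norm (v - u).
Proof.
rewrite !L2normE; congr Num.sqrt; rewrite !rinnerE; apply: eq_bigr => i _.
by apply: eq_Rintegral => x _; rewrite !mxE !(ReD, ImD, ReN, ImN); ring.
Qed.

Lemma square_integrable_complete (u : nat -> F) :
  (forall n, square_integrable (u n)) ->
  (forall e, 0 < e -> exists N, forall n m, (N <= n)%N -> (N <= m)%N ->
    L2norm (u n - u m) < e) ->
  exists2 v, square_integrable v & L2norm (u n - v) @[n --> \oo] --> 0.
Proof.
move=> u2 cu.
have uB2 n m : square_integrable (u n - u m).
  by rewrite addrC -scaleN1r; exact: square_integrable_linear.
have cu2 e : 0 < e -> exists N, forall n m, (N <= n)%N -> (N <= m)%N ->
    rinner (u n - u m) (u n - u m) < e.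
  move=> e0; have [N NP] := cu (Num.sqrt e) ltac:(by rewrite sqrtr_gt0).
  exists N => n m Nn Nm; rewrite -L2norm_sqr -(@sqr_sqrtr _ e) ?ltW//.
  by rewrite ltr_sqr ?nnegrE ?L2norm_ge0 ?sqrtr_ge0//; exact: NP.
have /choice[r rP] : forall i, exists g, g \in Lfun leb6 2%:E /\
    forall e, 0 < e -> exists N, forall n, (N <= n)%N ->
      \int[leb6]_x ((Re (u n x i 0) - g x) ^+ 2) <= e.
  move=> i; have [|e e0|g g2 gP] := @Lfun2_complete _ _ _ leb6 (fun n x => Re (u n x i 0)).
  - by move=> n; have [] := u2 n i.
  - have [N NP] := cu2 e e0; exists N => n m Nn Nm.
    have [h _] := rinner_norm_component i (uB2 n m).
    apply: le_lt_trans (NP n m Nn Nm); apply: le_trans h; rewrite le_eqVlt; apply/orP; left.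
    by apply/eqP; apply: eq_Rintegral => x _; rewrite !mxE ReD ReN.
  - by exists g.
have /choice[s sP] : forall i, exists g, g \in Lfun leb6 2%:E /\
    forall e, 0 < e -> exists N, forall n, (N <= n)%N ->
      \int[leb6]_x ((Im (u n x i 0) - g x) ^+ 2) <= e.
  move=> i; have [|e e0|g g2 gP] := @Lfun2_complete _ _ _ leb6 (fun n x => Im (u n x i 0)).
  - by move=> n; have [] := u2 n i.
  - have [N NP] := cu2 e e0; exists N => n m Nn Nm.
    have [_ h] := rinner_norm_component i (uB2 n m).
    apply: le_lt_trans (NP n m Nn Nm); apply: le_trans h; rewrite le_eqVlt; apply/orP; left.
    by apply/eqP; apply: eq_Rintegral => x _; rewrite !mxE ImD ImN.
  - by exists g.
pose v : F := fun x => \col_i (r i x +i* s i x).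
have v2 : square_integrable v.
  move=> i; split; under eq_fun do rewrite mxE /=; first by have [] := rP i.
  by have [] := sP i.
exists v => //; apply/cvgrPdist_le => e e0.
(* The squared norm is a sum over 16 complex, hence 32 real, components. *)
have d0 : 0 < e ^+ 2 / 32 by rewrite divr_gt0// exprn_gt0.
have /choice[N NP] : forall i, exists N, forall n, (N <= n)%N ->
   \int[leb6]_x ((Re (u n x i 0) - r i x) ^+ 2) + \int[leb6]_x ((Im (u n x i 0) - s i x) ^+ 2)
      <= e ^+ 2 / 16.
  move=> i; have [_ /(_ _ d0)[N1 N1P]] := rP i; have [_ /(_ _ d0)[N2 N2P]] := sP i.
  exists (maxn N1 N2) => n; rewrite geq_max => /andP[/N1P h1 /N2P h2].
  by lra.
exists (\max_i N i)%N => // n /= Nn.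
rewrite sub0r normrN ger0_norm ?L2norm_ge0//.
rewrite -ler_sqr ?nnegrE ?L2norm_ge0 ?(ltW e0)// L2norm_sqr rinnerE.
apply: (@le_trans _ _ (\sum_(i < (4 + 4) + (4 + 4)) (e ^+ 2 / 16))); last first.
  by rewrite sumr_const card_ord -mulr_natr; lra.
apply: ler_sum => i _.
have uv : square_integrable (u n - v).
  by rewrite addrC -scaleN1r; exact: square_integrable_linear.
have /(NP i) : (N i <= n)%N by apply: leq_trans Nn; exact: leq_bigmax.
apply: le_trans; rewrite le_eqVlt; apply/orP; left; apply/eqP.
have [h1 h2] := uv i.
rewrite -RintegralD//; last 2 first.
- have := Lfun2_integrable_sqr h1; congr (integrable _ _ _).
  by apply/funext => x /=; rewrite !mxE ReD ReN.
- have := Lfun2_integrable_sqr h2; congr (integrable _ _ _).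
  by apply/funext => x /=; rewrite !mxE ImD ImN.
by apply: eq_Rintegral => x _; rewrite !mxE !(ReD, ImD, ReN, ImN)/= -!expr2.
Qed.

End wave_functions.

(** * The antisymmetric subspace *)

Section antisymmetric_subspace.
Variable R : realType.
Local Notation C := R[i].
Local Notation F := (wavefun R).
Local Notation Re := (@complex.Re R).
Local Notation Im := (@complex.Im R).
Local Notation mR6 := (measurableTypeR R * measurableTypeR R * measurableTypeR R *
  (measurableTypeR R * measurableTypeR R * measurableTypeR R))%type.
Implicit Types (u v w : F) (a : R) (z : C).

Definition exchange (x : R6 R) : R6 R := (x.2, x.1).

Lemma measurable_exchange : measurable_fun setT (exchange : mR6 -> mR6).
Proof. exact: measurable_fun_pair. Qed.

(** The image measure agrees with [leb6] on rectangles, and a product measure is determined by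
    them. *)
Lemma leb6_exchange (A : set mR6) : measurable A -> leb6 (exchange @^-1` A) = leb6 A.
Proof.
move=> mA; apply/esym.
rewrite -[RHS]/(pushforward (@leb6 R) (exchange : mR6 -> mR6) A).
rewrite {1}/leb6; apply: product_measure_unique => //.
  exact: measurable_exchange.
move=> ? B D mB mD; rewrite /= /pushforward.
have -> : exchange @^-1` (B `*` D) = D `*` B.
  by apply/seteqP; split => -[x y] /= [].
by rewrite /leb6 product_measure1E// muleC.
Qed.

Lemma Lfun2_exchange (f : R6 R -> R) : f \in Lfun leb6 2%:E ->
  (f \o exchange) \in Lfun leb6 2%:E /\
  \int[leb6]_x ((f (exchange x)) ^+ 2) = \int[leb6]_x (f x ^+ 2).
Proof.
move=> /Lfun2P[mf if2].
have mf' : measurable_fun setT (f \o exchange : mR6 -> R).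
  by apply: measurableT_comp => //; exact: measurable_exchange.
have E : (\int[leb6]_x ((f (exchange x)) ^+ 2)%:E = \int[leb6]_x (f x ^+ 2)%:E)%E.
  have := @ge0_integral_pushforward _ _ _ _ R _ measurable_exchange leb6 setT
    (fun x => (f x ^+ 2)%:E) measurableT.
  rewrite preimage_setT => <-.
  - apply: eq_measure_integral; first exact: measurable_exchange.
    by move=> ? A mA _; exact: leb6_exchange.
  - by apply/measurable_EFinP/measurable_funX.
  - by move=> x _; rewrite lee_fin sqr_ge0.
split; last by rewrite /Rintegral E.
apply/Lfun2P; split => //; apply/integrableP; split.
  by apply/measurable_EFinP/measurable_funX.
have /integrableP[_] := if2; rewrite /comp /=.
under eq_integral do rewrite ger0_norm ?sqr_ge0//.
by under [X in _ -> (X < _)%E]eq_integral do rewrite ger0_norm ?sqr_ge0//; rewrite E.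
Qed.

(* [Mat a i j] is the entry [2 j + i] of [a]. *)
Definition Mat_index (i j : 'I_2) : 'I_4 := inord (val i + 2 * val j).

Lemma MatE (a : 'cV[C]_4) i j : Mat a i j = a (Mat_index i j) 0.
Proof.
rewrite /Mat /mx2 mxE /Mat_index.
by case: i => -[|[|//]] ?; case: j => -[|[|//]] ?.
Qed.

(** The pairs of components tied together by the three block conditions. Transposition becomes a
    swap of indices, and antisymmetry a finite family of scalar identities, to which limits apply
    one at a time. *)
Inductive exchanged : 'I_((4 + 4) + (4 + 4)) -> 'I_((4 + 4) + (4 + 4)) -> Prop :=
| exchanged11 i j : exchanged (lshift _ (lshift _ (Mat_index i j)))
                              (lshift _ (lshift _ (Mat_index j i)))
| exchanged22 i j : exchanged (rshift _ (rshift _ (Mat_index i j)))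
                              (rshift _ (rshift _ (Mat_index j i)))
| exchanged12 i j : exchanged (lshift _ (rshift _ (Mat_index i j)))
                              (rshift _ (lshift _ (Mat_index j i))).

Lemma exchange_antisymmetricP u : exchange_antisymmetric u <->
  {ae leb6, forall x : R6 R, forall s t, exchanged s t ->
     u (exchange x) s 0 = - u x t 0}.
Proof.
have MatP (a b : 'cV[C]_4) : Mat a = - (Mat b)^T <->
    forall i j, a (Mat_index i j) 0 = - b (Mat_index j i) 0.
  split=> [/matrixP H i j|H]; last first.
    by apply/matrixP => i j; rewrite MatE H [RHS]mxE [X in _ = - X]mxE MatE.
  by rewrite -MatE H [LHS]mxE [X in - X = _]mxE MatE.
split; apply: filterS => x.
- move=> /= [/MatP h1 /MatP h2 /MatP h3] s t [] i j.
  + by have := h1 i j; rewrite !mxE.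
  + by have := h2 i j; rewrite !mxE.
  + by have := h3 i j; rewrite !mxE.
- move=> H; split; apply/MatP => i j; rewrite !mxE; apply: H;
    first [exact: exchanged11|exact: exchanged22|exact: exchanged12].
Qed.

Lemma HA2_linear z u v : HA2 u -> HA2 v -> HA2 (z *: u + v).
Proof.
move=> [u2 /exchange_antisymmetricP ua] [v2 /exchange_antisymmetricP va]; split.
  exact: square_integrable_linear.
apply/exchange_antisymmetricP; apply: filterS2 ua va => x ux vx s t st.
by rewrite !mxE (ux s t st) (vx s t st) mulrN opprD.
Qed.

(** The defect [h] equals, up to sign and almost everywhere, the sum of the errors [p n - f]
    (exchanged) and [q n - g]. As the exchange preserves the measure, the integral of [h ^+ 2] is
    arbitrarily small. *)
Lemma Lfun2_exchange_limit (f g : R6 R -> R) (p q : nat -> R6 R -> R) :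
  f \in Lfun leb6 2%:E -> g \in Lfun leb6 2%:E ->
  (forall n, p n \in Lfun leb6 2%:E) -> (forall n, q n \in Lfun leb6 2%:E) ->
  (forall n, {ae leb6, forall x : R6 R, p n (exchange x) = - q n x}) ->
  (forall e, 0 < e -> exists n, \int[leb6]_x ((p n x - f x) ^+ 2) <= e /\
                                \int[leb6]_x ((q n x - g x) ^+ 2) <= e) ->
  {ae leb6, forall x : R6 R, f (exchange x) = - g x}.
Proof.
have sqrD_le2 (a b : R) : (a + b) ^+ 2 <= 2 * a ^+ 2 + 2 * b ^+ 2.
  by have := sqr_ge0 (a - b); nra.
have quarters (a b e : R) : a <= e / 4 -> b <= e / 4 -> 2 * a + 2 * b <= e by lra.
move=> f2 g2 p2 q2 pq lim.
have [fs2 _] := Lfun2_exchange f2.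
pose h x := f (exchange x) + g x.
have h2 : h \in Lfun leb6 2%:E.
  have -> : h = (fun x => 1 * (f \o exchange) x + g x).
    by apply/funext => x; rewrite mul1r.
  exact: Lfun2_linear.
have sub2 (a b : R6 R -> R) : a \in Lfun leb6 2%:E -> b \in Lfun leb6 2%:E ->
    (fun x => a x - b x) \in Lfun leb6 2%:E.
  move=> a2 b2; have -> : (fun x => a x - b x) = (fun x => (-1) * b x + a x).
    by apply/funext => x; rewrite mulN1r addrC.
  exact: Lfun2_linear.
suff h0 : \int[leb6]_x (h x ^+ 2) = 0.
  have := Lfun2_ae_eq0 h2 h0; apply: filterS => x.
  by rewrite /h => /eqP; rewrite addr_eq0 => /eqP.
apply/eqP; rewrite eq_le; apply/andP; split; last first.
  by apply: Rintegral_ge0 => x _; exact: sqr_ge0.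
apply/ler_addgt0Pr => e e0; rewrite add0r.
have [n [hp hq]] := lim (e / 4) ltac:(by rewrite divr_gt0).
have [ps2 psE] := Lfun2_exchange (sub2 _ _ (p2 n) f2).
have qg2 := sub2 _ _ (q2 n) g2.
have ip := Lfun2_integrable_sqr ps2; have iq := Lfun2_integrable_sqr qg2.
have mps : measurable_fun setT ((fun x => p n x - f x) \o exchange : mR6 -> R).
  by have /Lfun2P[] := ps2.
have mqg : measurable_fun setT ((fun x => q n x - g x) : mR6 -> R).
  by have /Lfun2P[] := qg2.
have -> : \int[leb6]_x (h x ^+ 2) =
   \int[leb6]_x ((((p n (exchange x) - f (exchange x)) + (q n x - g x))) ^+ 2).
  rewrite /Rintegral; congr fine; apply: ae_eq_integral => //.
  - by apply/measurable_EFinP/measurable_funX; have /Lfun2P[] := h2.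
  - by apply/measurable_EFinP/measurable_funX/measurable_funD.
  - have := pq n; apply: filterS => x H _.
    by rewrite H /h; congr (_%:E); ring.
apply: (@le_trans _ _ (\int[leb6]_x (2 * (p n (exchange x) - f (exchange x)) ^+ 2
    + 2 * (q n x - g x) ^+ 2))).
  apply: le_Rintegral => //.
  - apply: Lfun2_integrable_sqr.
    have -> : (fun x => p n (exchange x) - f (exchange x) + (q n x - g x)) =
      (fun x => 1 * ((fun x => p n x - f x) \o exchange) x + (q n x - g x)).
      by apply/funext => x; rewrite mul1r.
    exact: Lfun2_linear.
  - have := integrableD measurableT (integrableZl measurableT 2 ip) (integrableZl measurableT 2 iq).
    by congr (integrable _ _ _); apply/funext.
rewrite RintegralD//; last 2 first.
- by have := integrableZl measurableT 2 ip; congr (integrable _ _ _); apply/funext.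
- by have := integrableZl measurableT 2 iq; congr (integrable _ _ _); apply/funext.
rewrite RintegralZl// RintegralZl//.
by apply: quarters => //; rewrite psE.
Qed.

Lemma HA2_complete (u : nat -> F) : (forall n, HA2 (u n)) ->
  (forall e, 0 < e -> exists N, forall n m, (N <= n)%N -> (N <= m)%N ->
    L2norm (u n - u m) < e) ->
  exists2 v, HA2 v & L2norm (u n - v) @[n --> \oo] --> 0.
Proof.
move=> uA cu.
have [v v2 uv] := square_integrable_complete (fun n => (uA n).1) cu.
exists v => //; split => //; apply/exchange_antisymmetricP.
have small e : 0 < e -> exists n, rinner (u n - v) (u n - v) <= e.
  move=> e0; have s0 : 0 < Num.sqrt e by rewrite sqrtr_gt0.
  move/cvgrPdist_le : uv => /(_ _ s0)[N _ /(_ N (leqnn _))].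
  rewrite sub0r normrN ger0_norm ?L2norm_ge0// => H; exists N.
  by rewrite -L2norm_sqr -(@sqr_sqrtr _ e) ?(ltW e0)// ler_sqr ?nnegrE ?L2norm_ge0 ?sqrtr_ge0.
have uv2 n : square_integrable (u n - v).
  by rewrite addrC -scaleN1r; apply: square_integrable_linear => //; exact: (uA n).1.
(* With the relation inside the almost-everywhere quantifier, the finitely many [s] and [t] can be
   gathered by [filter_forall]. *)
have H s t : {ae leb6, forall x : R6 R, exchanged s t -> v (exchange x) s 0 = - v x t 0}.
  have [st|nst] := pselect (exchanged s t); last by apply: nearW => x.
  have aeu n : {ae leb6, forall x : R6 R, u n (exchange x) s 0 = - u n x t 0}.
    by have /exchange_antisymmetricP := (uA n).2; apply: filterS => x; exact.
  have aer : {ae leb6, forall x : R6 R, Re (v (exchange x) s 0) = - Re (v x t 0)}.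
    apply: (Lfun2_exchange_limit (f := fun x => Re (v x s 0)) (g := fun x => Re (v x t 0))
      (p := fun n x => Re (u n x s 0)) (q := fun n x => Re (u n x t 0))).
    - by have [] := v2 s.
    - by have [] := v2 t.
    - by move=> n; have [] := (uA n).1 s.
    - by move=> n; have [] := (uA n).1 t.
    - by move=> n; have := aeu n; apply: filterS => x ->; rewrite ReN.
    - move=> e /small[n ne]; exists n.
      have [h1 _] := rinner_norm_component s (uv2 n).
      have [h2 _] := rinner_norm_component t (uv2 n).
      split; [apply: le_trans ne; apply: le_trans h1|apply: le_trans ne; apply: le_trans h2];
      by rewrite le_eqVlt; apply/orP; left; apply/eqP; apply: eq_Rintegral => x _; rewrite !mxE ReD ReN.
  have aei : {ae leb6, forall x : R6 R, Im (v (exchange x) s 0) = - Im (v x t 0)}.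
    apply: (Lfun2_exchange_limit (f := fun x => Im (v x s 0)) (g := fun x => Im (v x t 0))
      (p := fun n x => Im (u n x s 0)) (q := fun n x => Im (u n x t 0))).
    - by have [] := v2 s.
    - by have [] := v2 t.
    - by move=> n; have [] := (uA n).1 s.
    - by move=> n; have [] := (uA n).1 t.
    - by move=> n; have := aeu n; apply: filterS => x ->; rewrite ImN.
    - move=> e /small[n ne]; exists n.
      have [_ h1] := rinner_norm_component s (uv2 n).
      have [_ h2] := rinner_norm_component t (uv2 n).
      split; [apply: le_trans ne; apply: le_trans h1|apply: le_trans ne; apply: le_trans h2];
      by rewrite le_eqVlt; apply/orP; left; apply/eqP; apply: eq_Rintegral => x _; rewrite !mxE ImD ImN.
  apply: filterS2 aer aei => x hr hi _.
  by apply/eqP; rewrite eq_complex ReN ImN hr hi !eqxx.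
by apply: filter_forall => s; apply: filter_forall => t; exact: H.
Qed.

End antisymmetric_subspace.

(** * Nonreal points belong to the resolvent set *)

Section self_adjoint_resolvent.
Variable R : realType.
Local Notation C := R[i].
Local Notation F := (wavefun R).
Local Notation Re := (@complex.Re R).
Local Notation Im := (@complex.Im R).
Implicit Types (u v w : F) (a : R) (z : C) (T : set (F * F)).

Lemma square_integrableB u v : square_integrable u -> square_integrable v ->
  square_integrable (u - v).
Proof. by move=> ? ?; rewrite addrC -scaleN1r; exact: square_integrable_linear. Qed.

Lemma HA2B u v : HA2 u -> HA2 v -> HA2 (u - v).
Proof. by move=> ? ?; rewrite addrC -scaleN1r; exact: HA2_linear. Qed.

Lemma HA2Z z u : HA2 u -> HA2 (z *: u).
Proof.
by move=> uA; rewrite -[z *: u]addr0 -(subrr u); apply: HA2_linear => //; exact: HA2B.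
Qed.

Lemma rinnerDl u v w : square_integrable u -> square_integrable v ->
  square_integrable w -> rinner (u + v) w = rinner u w + rinner v w.
Proof.
move=> u2 v2 w2; have := rinner_linearl 1 u2 v2 w2.
by rewrite (_ : 1%:C = 1)// scale1r mul1r.
Qed.

Lemma rinnerDr u v w : square_integrable u -> square_integrable v ->
  square_integrable w -> rinner w (u + v) = rinner w u + rinner w v.
Proof. by move=> u2 v2 w2; rewrite !(rinnerC w); exact: rinnerDl. Qed.

Lemma rinnerBl u v w : square_integrable u -> square_integrable v ->
  square_integrable w -> rinner (u - v) w = rinner u w - rinner v w.
Proof.
move=> u2 v2 w2; have := rinner_linearl (-1) v2 u2 w2.
by rewrite (_ : (-1)%:C = -1) ?rmorphN1// scaleN1r mulN1r addrC => ->; rewrite addrC.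
Qed.

Lemma rinnerBr u v w : square_integrable u -> square_integrable v ->
  square_integrable w -> rinner w (u - v) = rinner w u - rinner w v.
Proof. by move=> u2 v2 w2; rewrite !(rinnerC w); exact: rinnerBl. Qed.

Lemma L2norm_cvg0 (u : nat -> F) v e : L2norm (u n - v) @[n --> \oo] --> 0 ->
  0 < e -> exists N, forall n, (N <= n)%N -> L2norm (u n - v) <= e.
Proof.
move=> /cvgrPdist_le H /H[N _ NP]; exists N => n /NP /=.
by rewrite sub0r normrN ger0_norm// L2norm_ge0.
Qed.

Lemma cvg_rinner (u : nat -> F) v w : (forall n, square_integrable (u n)) ->
  square_integrable v -> square_integrable w ->
  L2norm (u n - v) @[n --> \oo] --> 0 -> rinner w (u n) @[n --> \oo] --> rinner w v.
Proof.
move=> u2 v2 w2 uv; apply/cvgrPdist_le => e e0.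
have W0 : 0 < L2norm w + 1 by rewrite ltr_wpDl// L2norm_ge0.
have /cvgrPdist_le/(_ _ (divr_gt0 e0 W0)) := uv; apply: filterS => n.
rewrite sub0r normrN ger0_norm ?L2norm_ge0// ler_pdivlMr// => H.
rewrite -rinnerBr//; apply: le_trans (rinner_CauchySchwarz w2 (square_integrableB v2 (u2 n))) _.
rewrite L2norm_distrC; apply: le_trans H.
by rewrite mulrC ler_wpM2l ?L2norm_ge0// lerDl.
Qed.

(** A minimising sequence is Cauchy by the parallelogram law, and varying its limit along [s] gives
    orthogonality. Everything is over the reals, in accordance with [rinner]. *)
Lemma projection_theorem (K : set F) w : K `<=` HA2 -> K 0 ->
  (forall a u v, K u -> K v -> K (a%:C *: u + v)) ->
  (forall (u : nat -> F) v, (forall n, K (u n)) -> HA2 v ->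
     L2norm (u n - v) @[n --> \oo] --> 0 -> K v) ->
  HA2 w -> exists2 r, K r & forall s, K s -> rinner s (w - r) = 0.
Proof.
(* Parallelogram law: [D] is the squared norm of p - q, [4 * M] that of p + q, and adding the two
   expansions removes the cross term [rho]. *)
have arith1 (d e f rho D X Y M : R) : D = (-1) ^+ 2 * X + 2 * (-1) * rho + Y ->
    (2 ^+ 2 + 0 ^+ 2) * M = 1 ^+ 2 * X + 2 * 1 * rho + Y ->
    X < d + e -> Y < d + f -> d <= M -> D <= 2 * (e + f) by lra.
have arith2 (a b e : R) : a < e / 4 -> b < e / 4 -> 2 * (a + b) < e by lra.
have arith3 (t d e X Y rho : R) : Y < d + e ->
   d <= (- t) ^+ 2 * X + 2 * (- t) * rho + Y ->
   0 <= t ^+ 2 * X - 2 * t * rho + e by rewrite sqrrN; lra.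
move=> KA K0 Klin Kcl wA.
have w2 := wA.1.
have K2 r : K r -> square_integrable r by move=> /KA[].
pose S := [set L2norm (w - r) ^+ 2 | r in K].
have infS : has_inf S.
  split; first by exists (L2norm (w - 0) ^+ 2); exists 0.
  by exists 0 => _ [r _ <-]; exact: sqr_ge0.
pose d := inf S.
have dmin r : K r -> d <= L2norm (w - r) ^+ 2.
  by move=> Kr; apply: ge_inf; [exact: infS.2|exists r].
have /choice[r rP] : forall n, exists r, K r /\ L2norm (w - r) ^+ 2 < d + n.+1%:R^-1.
  move=> n; have [|_ [r Kr <-] rd] := @inf_adherent _ S n.+1%:R^-1 _ infS.
    by rewrite invr_gt0.
  by exists r.
have Kr n : K (r n) by have [] := rP n.
have r2 n := K2 _ (Kr n).
have wr2 n : square_integrable (w - r n) by exact: square_integrableB.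
have parallelogram n m : L2norm (r n - r m) ^+ 2 <= 2 * (n.+1%:R^-1 + m.+1%:R^-1).
  set p := w - r n; set q := w - r m.
  have p2 : square_integrable p by exact: wr2.
  have q2 : square_integrable q by exact: wr2.
  have E1 : r n - r m = (-1)%:C *: p + q.
    rewrite (_ : (-1)%:C = -1) ?rmorphN1// scaleN1r /p /q opprB addrA addrNK.
    by [].
  (* The midpoint, written so that [Klin] applies twice. *)
  pose mid : F := (2^-1)%:C *: r n + ((2^-1)%:C *: r m + 0).
  have Kmid : K mid by apply: (Klin) => //; exact: (Klin).
  have h2 : (2 : R)%:C * (2^-1)%:C = 1 :> C by rewrite -rmorphM/= mulfV// rmorph1.
  have E2 : 1%:C *: p + q = (2 : R)%:C *: (w - mid).
    rewrite (_ : 1%:C = 1)// scale1r /mid addr0 scalerBr scalerDr !scalerA h2 !scale1r.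
    rewrite (_ : (2 : R)%:C = 1 + 1); last by rewrite -[2]/(1 + 1) rmorphD /= rmorph1.
    by rewrite scalerDl scale1r /p /q addrACA opprD.
  have H1 := L2norm_linear_sqr (-1) p2 q2; rewrite -E1 in H1.
  have H2 := L2norm_linear_sqr 1 p2 q2; rewrite E2 L2normZ/= in H2; last first.
    by apply: square_integrableB => //; exact: K2.
  exact: (arith1 d _ _ _ _ _ _ _ H1 H2 (rP n).2 (rP m).2 (dmin _ Kmid)).
have cau e : 0 < e -> exists N, forall n m, (N <= n)%N -> (N <= m)%N ->
    L2norm (r n - r m) < e.
  move=> e0; have d0 : 0 < e ^+ 2 / 4 by rewrite divr_gt0// exprn_gt0.
  have [N _ NP] := near_infty_natSinv_lt (PosNum d0).
  exists N => n m Nn Nm; rewrite -ltr_sqr ?nnegrE ?L2norm_ge0 ?(ltW e0)//.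
  apply: le_lt_trans (parallelogram n m) _.
  by apply: arith2; [exact: NP n Nn|exact: NP m Nm].
have [y yA ry] := HA2_complete (fun n => KA _ (Kr n)) cau.
have Ky : K y by exact: Kcl ry.
exists y => // s Ks.
have s2 := K2 _ Ks; have y2 := K2 _ Ky; have wy2 := square_integrableB w2 y2.
have wry : rinner s (w - r n) @[n --> \oo] --> rinner s (w - y).
  apply: (cvg_rinner (u := fun n => w - r n) wr2 wy2 s2).
  suff -> : (fun n => L2norm (w - r n - (w - y))) = (fun n => L2norm (r n - y)) by [].
  apply/funext => n; rewrite L2norm_distrC; congr L2norm.
  by rewrite opprB addrC addrA subrK.
(* Compare the competitor [r n + t s] with the infimum [d], which [r n] attains up to 1 / (n + 1),
   and let n tend to infinity. *)
have H t : 0 <= t ^+ 2 * L2norm s ^+ 2 - 2 * t * rinner s (w - y).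
  have lim : t ^+ 2 * L2norm s ^+ 2 - 2 * t * rinner s (w - r n) + n.+1%:R^-1 @[n --> \oo]
      --> t ^+ 2 * L2norm s ^+ 2 - 2 * t * rinner s (w - y) + 0.
    apply: cvgD; last exact: cvg_harmonic.
    by apply: cvgB; [exact: cvg_cst|apply: cvgM => //; exact: cvg_cst].
  rewrite addr0 in lim.
  apply: cvgr_to_ge lim _; apply: nearW => n.
  have := dmin _ (Klin t _ _ Ks (Kr n)).
  have -> : w - (t%:C *: s + r n) = (- t)%:C *: s + (w - r n).
    by rewrite rmorphN scaleNr opprD addrCA.
  by rewrite L2norm_linear_sqr//; apply: arith3; exact: (rP n).2.
apply/eqP; apply: contraT => rho0.
have S1 : 0 < L2norm s ^+ 2 + 1 by rewrite ltr_wpDl// sqr_ge0.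
(* A near-minimiser in [t]; the added 1 keeps the denominator positive when [s] has norm zero. *)
have := H (rinner s (w - y) / (L2norm s ^+ 2 + 1)).
set rho := rinner _ _ in rho0 *; set N := L2norm s ^+ 2 in S1 *.
have -> : (rho / (N + 1)) ^+ 2 * N - 2 * (rho / (N + 1)) * rho =
    - (rho ^+ 2 * (N + 2)) / (N + 1) ^+ 2 by field; rewrite gt_eqF.
rewrite mulNr oppr_ge0 pmulr_lle0 ?invr_gt0 ?exprn_gt0// leNgt => /negP[].
by rewrite mulr_gt0 ?exprn_even_gt0//; move: S1; lra.
Qed.

(** By symmetry the product of [u] and [v] is real, so [v - Re z u] and [i Im z u] are orthogonal
    for [rinner], and Pythagoras applies to [v - z u]. *)
Lemma self_adjoint_resolvent_bound T z u v : self_adjoint HA2 T -> T (u, v) ->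
  Im z ^+ 2 * L2norm u ^+ 2 <= L2norm (v - z *: u) ^+ 2.
Proof.
move=> [[TA Tlin _ _] _ Tadj] Tuv.
have [uA vA] := TA _ Tuv; have u2 : square_integrable u := uA.1; have v2 : square_integrable v := vA.1.
pose c : C := 0 +i* Im z.
have cJ : (c^*)%C = - c by apply/eqP; rewrite eq_complex /= oppr0 !eqxx.
have cNJ : ((- c)^*)%C = c by apply/eqP; rewrite eq_complex /= oppr0 opprK !eqxx.
have cu2 : square_integrable (c *: u) by have [] := HA2Z c uA.
have cuu : rinner (c *: u) u = 0.
  have := rinnerZ c u u; rewrite cJ scaleNr.
  have := rinnerBr (square_integrableB u2 u2) cu2 u2.
  have -> : rinner u (u - u) = 0.
    by rewrite rinnerBr// subrr.
  rewrite subrr sub0r => -> ; rewrite rinnerC; lra.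
(* Symmetry tested on [(c u, c v)] and [(u, v)]: since [c] is imaginary, this product equals its own
   opposite. *)
have cuv : rinner (c *: u) v = 0.
  have Tc : T (c *: u, c *: v).
    have := Tlin (-1) u v u v Tuv Tuv; rewrite !scaleN1r !addNr => T0.
    by have := Tlin c u v 0 0 Tuv T0; rewrite !addr0.
  have : T `<=` adjoint HA2 T by rewrite Tadj.
  move=> /(_ _ Tc) [_ _ /(_ _ _ Tuv)] /(congr1 Re); rewrite -!/(rinner _ _) /=.
  have -> : rinner u (c *: v) = rinner ((- c) *: u) v.
    by rewrite rinnerZ cNJ.
  rewrite scaleNr -[- _]add0r.
  have z2 : square_integrable (0 : F) by rewrite -(subrr u); exact: square_integrableB.
  rewrite rinnerBl// -{1}(subrr u) rinnerBl// subrr sub0r rinnerC; lra.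
have -> : v - z *: u = (-1)%:C *: (c *: u) + ((- Re z)%:C *: u + v).
  have {1}-> : z = c + (Re z)%:C.
    by apply/eqP; rewrite eq_complex /= add0r addr0 !eqxx.
  by rewrite !rmorphN rmorph1 scaleN1r scaleNr scalerDl opprD addrC -addrA.
have uv2 : square_integrable ((- Re z)%:C *: u + v) by exact: square_integrable_linear.
have cuw : rinner (c *: u) ((- Re z)%:C *: u + v) = 0.
  by rewrite rinnerC (rinner_linearl _ u2 v2 cu2) (rinnerC u) cuu (rinnerC v) cuv mulr0 addr0.
have arith (I U A r B : R) : A = (0 ^+ 2 + I ^+ 2) * U -> r = 0 -> 0 <= B ->
    I ^+ 2 * U <= (-1) ^+ 2 * A + 2 * (-1) * r + B.
  by move=> -> -> B0; rewrite expr0n/= add0r sqrrN expr1n mul1r mulr0 addr0 lerDl.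
rewrite [X in _ <= X](L2norm_linear_sqr (-1) cu2 uv2).
by apply: arith; [exact: (L2normZ c u2)|exact: cuw|exact: sqr_ge0].
Qed.

Lemma self_adjoint_nonreal_resolvent T z : self_adjoint HA2 T -> Im z != 0 ->
  resolvent_set HA2 T z.
Proof.
have arith (x : R) : 0 < x -> x / 3 + x / 3 < x by lra.
move=> saT z0; have [[TA Tlin Tae _] dense Tadj] := saT.
(* Self-adjointness as maximality. The imaginary part of the adjoint identity comes from testing
   with ['i%C *: u']; such multiples lie in [T] because (0, 0) does, as a difference of a pair
   supplied by density with itself. *)
have Tin u v : HA2 u -> HA2 v ->
    (forall u' v', T (u', v') -> rinner v' u = rinner u' v) -> T (u, v).
  move=> uA vA H; rewrite -Tadj; split => // u' v' T'; apply: inner_eq; first exact: H.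
  have [u'' [v'' [T'' _]]] := dense _ uA 1 ltr01.
  have := Tlin (-1) _ _ _ _ T'' T''; rewrite !scaleN1r !addNr => T0.
  by apply: H; have := Tlin 'i%C u' v' 0 0 T' T0; rewrite !addr0.
have bound := fun u v => @self_adjoint_resolvent_bound T z u v saT.
have z2_gt0 : 0 < Im z ^+ 2 by rewrite exprn_even_gt0.
split; last first.
  exists (`|Im z|^-1) => u v Tuv.
  rewrite -ler_pdivrMl ?invr_gt0 ?normr_gt0// invrK.
  rewrite -ler_sqr ?nnegrE ?mulr_ge0 ?L2norm_ge0//.
  by rewrite exprMn real_normK ?num_real//; exact: bound.
move=> w wA.
pose K := [set s | exists u v, T (u, v) /\ s = v - z *: u].
have KA : K `<=` HA2.
  by move=> _ [u [v [/TA[/= uA vA] ->]]]; apply: HA2B => //; exact: HA2Z.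
have K0 : K 0.
  have [u [v [Tuv _]]] := dense _ wA 1 ltr01.
  have := Tlin (-1) _ _ _ _ Tuv Tuv; rewrite !scaleN1r !addNr => T0.
  by exists 0, 0; split => //; rewrite scaler0 subrr.
have Klin a u v : K u -> K v -> K (a%:C *: u + v).
  move=> [u1 [v1 [T1 ->]]] [u2 [v2 [T2 ->]]].
  exists (a%:C *: u1 + u2), (a%:C *: v1 + v2); split; first exact: Tlin.
  by rewrite scalerBr scalerDr !scalerA [z * _]mulrC opprD addrACA.
have Kcl (s : nat -> F) t : (forall n, K (s n)) -> HA2 t ->
    L2norm (s n - t) @[n --> \oo] --> 0 -> K t.
  move=> Ks tA st.
  have /choice[p pP] : forall n, exists p, T p /\ s n = p.2 - z *: p.1.
    by move=> n; have [u [v [Tuv ->]]] := Ks n; exists (u, v).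
  have Tp n : T ((p n).1, (p n).2) by rewrite -surjective_pairing; exact: (pP n).1.
  have p1A n : HA2 (p n).1 by have [] := TA _ (Tp n).
  have p2A n : HA2 (p n).2 by have [] := TA _ (Tp n).
  have sE n : s n = (p n).2 - z *: (p n).1 := (pP n).2.
  have sA n : HA2 (s n) := KA _ (Ks n).
  have [e e0|u uA pu] := HA2_complete p1A.
    (* Two such errors add up to less than [|Im z| * e], and the resolvent bound divides by
       [|Im z|]. *)
    have d0 : 0 < `|Im z| * e / 3 by rewrite divr_gt0// mulr_gt0// normr_gt0.
    have [N NP] := L2norm_cvg0 st d0; exists N => n m Nn Nm.
    have hn := NP n Nn; have hm := NP m Nm.
    have Tnm : T ((p n).1 - (p m).1, (p n).2 - (p m).2).
      by have := Tlin (-1) _ _ _ _ (Tp m) (Tp n); rewrite !scaleN1r ![- _ + _]addrC.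
    have := bound _ _ Tnm.
    have -> : (p n).2 - (p m).2 - z *: ((p n).1 - (p m).1) = s n - s m.
      by rewrite !sE scalerBr !opprB addrACA [in RHS]addrACA; congr (_ + _); rewrite addrC.
    rewrite -(real_normK (num_real (Im z))) -exprMn ler_sqr ?nnegrE ?mulr_ge0 ?L2norm_ge0//.
    have : L2norm (s n - s m) <= `|Im z| * e / 3 + `|Im z| * e / 3.
      have -> : s n - s m = (s n - t) + (t - s m) by rewrite addrA subrK.
      apply: le_trans (L2normD _ _) _; [exact: (HA2B (sA n) tA).1|exact: (HA2B tA (sA m)).1|].
      by rewrite [L2norm (t - _)]L2norm_distrC; exact: lerD hn hm.
    move=> h1 h2; have := le_trans h2 h1.
    have Z0 : 0 < `|Im z| by rewrite normr_gt0.
    rewrite -(@ltr_pM2l _ `|Im z|)// => h3; apply: le_lt_trans h3 _.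
    by apply: arith; rewrite mulr_gt0.
  have vA : HA2 (z *: u + t) by exact: HA2_linear.
  (* The images need no Cauchy argument of their own: [(p n).2] is [s n + z (p n).1], whose limit is
     this vector. *)
  exists u, (z *: u + t); split; last by rewrite addrC addKr.
  apply: Tin => // u' v' T'.
  have [u'A v'A] := TA _ T'.
  have l1 : rinner v' (p n).1 @[n --> \oo] --> rinner v' u.
    by apply: cvg_rinner => // [n||]; [exact: (p1A n).1|exact: uA.1|exact: v'A.1].
  have l2 : rinner ((z^*)%C *: u') (p n).1 + rinner u' (s n) @[n --> \oo] -->
      rinner ((z^*)%C *: u') u + rinner u' t.
    apply: cvgD.
      by apply: cvg_rinner => // [n||]; [exact: (p1A n).1|exact: uA.1|exact: (HA2Z _ u'A).1].
    by apply: cvg_rinner => // [n||]; [exact: (sA n).1|exact: tA.1|exact: u'A.1].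
  rewrite rinnerDr; [|exact: (HA2Z _ uA).1|exact: tA.1|exact: u'A.1].
  have <- : rinner ((z^*)%C *: u') u = rinner u' (z *: u) by rewrite rinnerZ conjcK.
  suff E : (fun n => rinner v' (p n).1) =
      (fun n => rinner ((z^*)%C *: u') (p n).1 + rinner u' (s n)).
    by rewrite E in l1; exact: (cvg_unique (@Rhausdorff R) l1 l2).
  apply/funext => n; rewrite rinnerZ conjcK -rinnerDr; [|exact: (HA2Z _ (p1A n)).1|exact: (sA n).1|exact: u'A.1].
  rewrite sE addrC subrK.
  have : T `<=` adjoint HA2 T by rewrite Tadj.
  by move=> /(_ _ (Tp n)) [_ _ /(_ _ _ T')] /(congr1 Re).
have [r Kr rP] := projection_theorem KA K0 Klin Kcl wA.
have rA := KA _ Kr.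
have yA : HA2 (w - r) by exact: HA2B.
(* Orthogonality to all [v' - z u'] is the adjoint identity for this pair once [z] is moved to the
   other side. *)
have Ty : T (w - r, (z^*)%C *: (w - r)).
  apply: Tin => //; first exact: HA2Z.
  move=> u' v' T'; have [u'A v'A] := TA _ T'.
  rewrite -rinnerZ; apply/eqP; rewrite -subr_eq0 -rinnerBl; last 3 first.
  - exact: v'A.1.
  - exact: (HA2Z _ u'A).1.
  - exact: yA.1.
  by rewrite rP//; exists u', v'.
have := self_adjoint_resolvent_bound (z^*)%C saT Ty.
rewrite subrr ImJ sqrrN.
have -> : L2norm (0 : F) ^+ 2 = 0.
  rewrite L2norm_sqr rinnerE big1// => i _.
  have -> : (fun x : R6 R => Re ((0 : F) x i 0) * Re ((0 : F) x i 0) + Im ((0 : F) x i 0) * Im ((0 : F) x i 0)) = (fun=> 0).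
    by apply/funext => x; rewrite !mxE /= mulr0 addr0.
  by rewrite /Rintegral integral0.
rewrite pmulr_rle0// => y0.
have {}y0 : rinner (w - r) (w - r) = 0.
  by apply/eqP; rewrite -L2norm_sqr eq_le y0 sqr_ge0.
have ae0 := rinner_eq0 yA.1 y0.
move: Kr => [u [v [Tuv rE]]]; exists u, v; split => //.
rewrite -rE; move: ae0; apply: filterS => x /= h.
by apply/esym/eqP; rewrite -subr_eq0; apply/eqP.
Qed.

End self_adjoint_resolvent.

(** * A smooth bump function *)

Section bump_functions.
Variable R : realType.
Implicit Types (f g : R -> R) (t : R) (n : nat).

(** Differentiability of order [n] in recursive form, which makes each closure property an induction
    on [n] for all functions at once. *)
Fixpoint Cn n f : Prop :=
  if n is n'.+1 then (forall t, derivable f t 1) /\ Cn n' (fun t => 'D_1 f t)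
  else True.

Lemma Cn_is_derive n f f' : (forall t, is_derive t 1 f (f' t)) -> Cn n f' -> Cn n.+1 f.
Proof.
move=> ff' nf'; split=> [t|]; first exact: ex_derive.
by have -> : (fun t => 'D_1 f t) = f' by apply/funext => t; exact: derive_val.
Qed.

Lemma CnS n f : Cn n.+1 f -> Cn n f.
Proof. by elim: n f => // n IH f [df nf]; split => //; exact: IH. Qed.

Lemma Cn_cst n (c : R) : Cn n (fun=> c).
Proof.
elim: n c => // n IH c; apply: (@Cn_is_derive _ _ (fun=> 0)) => // t.
Qed.

Lemma CnD n f g : Cn n f -> Cn n g -> Cn n (fun t => f t + g t).
Proof.
elim: n f g => // n IH f g [df nf] [dg ng].
apply: (@Cn_is_derive _ _ (fun t => 'D_1 f t + 'D_1 g t)) => [t|]; last exact: IH.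
by apply: is_deriveD; exact/derivableP.
Qed.

Lemma CnM n f g : Cn n f -> Cn n g -> Cn n (fun t => f t * g t).
Proof.
elim: n f g => // n IH f g /[dup] /CnS nf0 [df nf] /[dup] /CnS ng0 [dg ng].
apply: (@Cn_is_derive _ _ (fun t => f t * 'D_1 g t + g t * 'D_1 f t)) => [t|].
  by apply: is_deriveM; exact/derivableP.
by apply: CnD; exact: IH.
Qed.

Lemma is_derive_affine (a c t : R) : is_derive t 1 (fun t => a * t + c) a.
Proof.
by apply: is_derive_eq; rewrite /= ?addr0 /GRing.scale /= mulr1 ?mulr0 ?addr0.
Qed.

Lemma Cn_affine n f (a c : R) : Cn n f -> Cn n (fun t => f (a * t + c)).
Proof.
elim: n f => // n IH f [df nf].
apply: (@Cn_is_derive _ _ (fun t => 'D_1 f (a * t + c) * a)) => [t|]; last first.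
  by apply: (CnM (IH _ nf)); exact: Cn_cst.
have -> : (fun t => f (a * t + c)) = f \o (fun t => a * t + c) by [].
by apply: is_derive1_comp; [exact/derivableP|exact: is_derive_affine].
Qed.

(** Differentiation stays in the span of the two functions, so the induction closes on general
    combinations. *)
Lemma Cn_cos_sin n (p a c : R) : Cn n (fun t => a * cos (p * t) + c * sin (p * t)).
Proof.
elim: n a c => // n IH a c.
apply: (@Cn_is_derive _ _ (fun t => (c * p) * cos (p * t) + (- a * p) * sin (p * t))) => // t.
have dp : is_derive t 1 (fun t => p * t) p.
  by apply: is_derive_eq; rewrite /GRing.scale /= mulr1 ?mulr0 ?addr0.
have dc : is_derive t 1 (fun t => cos (p * t)) (- sin (p * t) * p).
  exact: (@is_derive1_comp _ cos (fun t => p * t)).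
have ds : is_derive t 1 (fun t => sin (p * t)) (cos (p * t) * p).
  exact: (@is_derive1_comp _ sin (fun t => p * t)).
apply: is_derive_eq.
by rewrite /GRing.scale /=; ring.
Qed.

(** For [n = 0] the classical smooth function that is flat at 0; the powers of [t^-1] make the span
    of the family stable under differentiation. *)
Definition flat n t : R := if 0 < t then t^-1 ^+ n * expR (- t^-1) else 0.

Lemma flat_ge0 n t : 0 <= flat n t.
Proof.
by rewrite /flat; case: ifP => // t0; rewrite mulr_ge0 ?expR_ge0// exprn_ge0// invr_ge0 ltW.
Qed.

(** One term of the exponential series at [t^-1] already dominates; the order 2 is what gives a zero
    derivative at the origin. *)
Lemma flat_le n t : flat n t <= (n.+2)`!%:R * t ^+ 2.
Proof.
rewrite /flat; case: ifPn => t0; last by rewrite mulr_ge0 ?sqr_ge0.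
have y0 : 0 < t^-1 by rewrite invr_gt0.
have := expR_ge1Dxn n.+1 (ltW y0).
rewrite expRN; set e := expR _ => he.
have e0 : 0 < e by exact: expR_gt0.
have F0 : 0 < (n.+2)`!%:R :> R by rewrite ltr0n fact_gt0.
rewrite ler_pdivrMr// -ler_pdivrMl ?mulr_gt0 ?exprn_gt0//.
apply: le_trans he; rewrite ler_wpDl// invfM mulrAC -mulrA mulrC.
rewrite -exprVn -exprD addn2 mulrC.
by rewrite lexx.
Qed.

Lemma is_derive_flat n t :
  is_derive t 1 (flat n) ((- n%:R) * flat n.+1 t + flat n.+2 t).
Proof.
have [t0|t0|t0] := ltgtP t 0.
- have -> : - n%:R * flat n.+1 t + flat n.+2 t = 0.
    by rewrite /flat ltNge (ltW t0)/= mulr0 addr0.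
  apply: (@near_eq_is_derive _ _ _ (cst 0) (flat n) t 1 0).
  have : \forall s \near t, s < 0 by exact: lt_nbhsl.
  by apply: filterS => s s0; rewrite /flat ltNge (ltW s0).
- apply: (@near_eq_is_derive _ _ _ (fun t => t^-1 ^+ n * expR (- t^-1))).
    have : \forall s \near t, 0 < s by exact: lt_nbhsr.
    by apply: filterS => s s0; rewrite /flat s0.
  have tN0 : t != 0 by rewrite gt_eqF.
  have dV : is_derive t 1 (fun t => t^-1) (- t ^- 2).
    have := @is_deriveV _ id t 1 1 tN0 _.
    by rewrite /GRing.scale /= mulr1; apply; exact: is_derive_id.
  have dE : is_derive t 1 (fun t => expR (- t^-1)) (expR (- t^-1) * t ^- 2).
    apply: (@is_derive1_comp _ expR (fun t => - t^-1)).
    by apply: is_derive_eq; rewrite opprK.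
  have dX : is_derive t 1 (fun t => t^-1 ^+ n) (n%:R * t^-1 ^+ n.-1 * (- t ^- 2)).
    have -> : (fun t : R => t^-1 ^+ n) = (fun t => t^-1) ^+ n.
      by elim: n => [|k IH]; apply/funext => s; rewrite ?expr0// !exprS -IH.
    exact: is_deriveX.
  apply: is_derive_eq; rewrite /flat t0 /GRing.scale /=.
  have -> : t ^- 2 = t^-1 * t^-1 by rewrite -exprVn expr2.
  case: n {dX} => [|n] /=; first by rewrite !exprS; ring.
  by rewrite !exprS; ring.
- rewrite t0 /flat ltxx mulr0 addr0.
  (* By [flat_le] the difference quotient is at most [(n.+2)!] times [|h|]. *)
  have lim : (fun h => h^-1 *: ((flat n \o shift 0) (h *: 1) - flat n 0)) @ 0^' --> (0 : R).
    apply/cvgrPdist_le => e e0.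
    have C0 : 0 < (n.+2)`!%:R :> R by rewrite ltr0n fact_gt0.
    near=> h.
    have h0 : h != 0 by near: h; exact: nbhs_dnbhs_neq.
    rewrite /= /GRing.scale /= addr0 mulr1 sub0r normrN {2}/flat ltxx subr0.
    rewrite normrM normrV ?unitfE// (ger0_norm (flat_ge0 _ _)).
    rewrite ler_pdivrMl ?normr_gt0//.
    apply: le_trans (flat_le n h) _.
    rewrite -(real_normK (num_real h)) expr2 mulrCA ler_wpM2l//.
    rewrite -ler_pdivlMl//.
    by near: h; apply: dnbhs0_le; rewrite mulr_gt0// invr_gt0.
  by apply: DeriveDef; [exact: cvgP lim|exact: (cvg_lim _ lim)].
Unshelve. all: by end_near. Qed.

Lemma Cn_flat k n : Cn k (flat n).
Proof.
elim: k n => // k IH n; apply: Cn_is_derive (is_derive_flat n) _.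
by apply: CnD => //; apply: CnM => //; exact: Cn_cst.
Qed.

(** Supported on [1, 2] and not around 0, so that dilation alone carries the support away from the
    origin. *)
Definition bump t : R := flat 0 (t - 1) * flat 0 (2 - t).

Lemma Cn_bump k : Cn k bump.
Proof.
have -> : bump = (fun t => flat 0 (1 * t + (- 1)) * flat 0 (-1 * t + 2)).
  by apply/funext => t; rewrite /bump mul1r mulN1r addrC [- t + _]addrC addrC.
by apply: CnM; apply: Cn_affine; exact: Cn_flat.
Qed.

Lemma derive_bump t : 'D_1 bump t =
  flat 2 (t - 1) * flat 0 (2 - t) - flat 0 (t - 1) * flat 2 (2 - t).
Proof.
have d1 : is_derive t 1 (fun t => flat 0 (t - 1)) (flat 2 (t - 1)).
  have := @is_derive1_comp _ (flat 0) (fun t => t - 1) t (flat 2 (t - 1)) 1.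
  rewrite mulr1; apply.
    by have := is_derive_flat 0 (t - 1); rewrite oppr0 mul0r add0r.
  by apply: is_derive_eq; rewrite subr0.
have d2 : is_derive t 1 (fun t => flat 0 (2 - t)) (- flat 2 (2 - t)).
  have := @is_derive1_comp _ (flat 0) (fun t => 2 - t) t (flat 2 (2 - t)) (-1).
  rewrite mulrN1; apply.
    by have := is_derive_flat 0 (2 - t); rewrite oppr0 mul0r add0r.
  have := is_derive_affine (-1) 2 t.
  by congr (is_derive _ _ _ _); apply/funext => s; rewrite mulN1r addrC.
have -> : bump = (fun t => flat 0 (t - 1)) * (fun t => flat 0 (2 - t)) by [].
by rewrite derive_val /GRing.scale /=; ring.
Qed.

Lemma flat_le0 n t : t <= 0 -> flat n t = 0.
Proof. by rewrite /flat ltNge => ->. Qed.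

Lemma bump_outside t : ~~ (1 < t < 2) -> bump t = 0 /\ 'D_1 bump t = 0.
Proof.
rewrite derive_bump /bump negb_and -!leNgt => /orP[t1|t2].
  have t1' : t - 1 <= 0 by rewrite subr_le0.
  by rewrite !(flat_le0 _ t1') !mul0r subrr.
have t2' : 2 - t <= 0 by rewrite subr_le0.
by rewrite !(flat_le0 _ t2') !mulr0 subrr.
Qed.

Lemma flat0_le1 t : flat 0 t <= 1.
Proof.
rewrite /flat; case: ifPn => // t0; rewrite expr0 mul1r -expR0 ler_expR.
by rewrite oppr_le0 invr_ge0 ltW.
Qed.

Lemma bump_ge0 t : 0 <= bump t. Proof. by rewrite mulr_ge0 ?flat_ge0. Qed.

Lemma bump_le1 t : bump t <= 1.
Proof. by rewrite mulr_ile1 ?flat_ge0 ?flat0_le1. Qed.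

Lemma derive_bump_le t : `|'D_1 bump t| <= 48.
Proof.
have [/andP[t1 t2]|/bump_outside[_ ->]] := boolP (1 < t < 2); last by rewrite normr0.
(* 24 is 4!, from [flat_le] with [n = 2]; the two terms of the derivative give 48. *)
have B s : 0 < s < 1 -> flat 2 s <= 24.
  move=> /andP[s0 s1]; apply: le_trans (flat_le 2 s) _.
  by rewrite ler_piMr// expr_le1// ltW.
have B1 : flat 2 (t - 1) <= 24 by apply: B; rewrite subr_gt0 t1/=; lra.
have B2 : flat 2 (2 - t) <= 24 by apply: B; rewrite subr_gt0 t2/=; lra.
rewrite derive_bump; apply: le_trans (ler_normB _ _) _.
rewrite !normrM !(ger0_norm (flat_ge0 _ _)).
have -> : (48 : R) = 24 * 1 + 1 * 24 by lra.
by apply: lerD; apply: ler_pM; rewrite ?flat_ge0 ?flat0_le1.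
Qed.

(** On the middle half of the support both [t - 1] and [2 - t] are at least 1/4. *)
Lemma bump_ge t : 5 / 4 <= t <= 7 / 4 -> expR (- 4) ^+ 2 <= bump t.
Proof.
move=> /andP[t1 t2].
have B s : 4^-1 <= s -> expR (- 4) <= flat 0 s.
  move=> s4; have s0 : 0 < s by apply: lt_le_trans s4; rewrite invr_gt0.
  by rewrite /flat s0 expr0 mul1r ler_expR lerN2 -[4]invrK lef_pV2// posrE invr_gt0.
by rewrite expr2; apply: ler_pM; rewrite ?expR_ge0//; apply: B; lra.
Qed.

End bump_functions.

(** * One-particle wave packets *)

Section separated_functions.
Variable R : realType.
Implicit Types (a b c : R -> R) (r : R3 R).

Definition prod3 a b c r : R := a r.1.1 * b r.1.2 * c r.2.

Definition Dprod3 (j : 'I_3) a b c : R3 R -> R :=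
  prod3 (if val j == 0%N then fun t => 'D_1 a t else a)
        (if val j == 1%N then fun t => 'D_1 b t else b)
        (if val j == 2%N then fun t => 'D_1 c t else c).

(** The two difference quotients are the same function, so partial derivatives reduce to calculus in
    one variable. *)
Lemma derive_line (f : R3 R -> R) r v (g : R -> R) x :
  (forall h, f (h *: v + r) = g (h + x)) ->
  (derivable f r v <-> derivable g x 1) /\ 'D_v f r = 'D_1 g x.
Proof.
move=> fg; have fr : f r = g x by have := fg 0; rewrite scale0r !add0r.
have E : (fun h => h^-1 *: ((f \o shift r) (h *: v) - f r)) =
         (fun h => h^-1 *: ((g \o shift x) (h *: 1) - g x)).
  by apply/funext => h; rewrite /= fg fr /GRing.scale /= mulr1.
by rewrite /derivable /derive E.
Qed.

Lemma derive_prod3 j a b c r : (forall t, derivable a t 1) ->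
  (forall t, derivable b t 1) -> (forall t, derivable c t 1) ->
  derivable (prod3 a b c) r (basis3 R j) /\
  'D_(basis3 R j) (prod3 a b c) r = Dprod3 j a b c r.
Proof.
move=> da db dc; case: r => -[x y] z.
(* Along one axis only the factor [f] varies; [K] gathers the two frozen factors. *)
have H (f : R -> R) s K : (forall t, derivable f t 1) ->
    (forall h, prod3 a b c (h *: basis3 R j + (x, y, z)) = f (h + s) * K) ->
    'D_1 f s * K = Dprod3 j a b c (x, y, z) ->
    derivable (prod3 a b c) (x, y, z) (basis3 R j) /\
    'D_(basis3 R j) (prod3 a b c) (x, y, z) = Dprod3 j a b c (x, y, z).
  move=> df fE DE.
  have [dd DD] := derive_line (g := fun t => f t * K) fE.
  have dfK : derivable (fun t => f t * K) s 1 by apply: derivableM.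
  split; first exact/dd.
  rewrite DD deriveM// derive_cst scaler0 add0r -DE.
  by rewrite /GRing.scale /= mulrC.
case: j H => -[|[|[|//]]] j3 H.
- apply: (H a x (b y * c z)) => // [h|]; last by rewrite /Dprod3 /prod3 /= mulrA.
  by rewrite /prod3 /= /GRing.scale /= mulr1 !mulr0 !add0r mulrA.
- apply: (H b y (a x * c z)) => // [h|]; last by rewrite /Dprod3 /prod3 /=; ring.
  by rewrite /prod3 /= /GRing.scale /= mulr1 !mulr0 !add0r; ring.
- apply: (H c z (a x * b y)) => // [h|]; last by rewrite /Dprod3 /prod3 /=; ring.
  by rewrite /prod3 /= /GRing.scale /= mulr1 !mulr0 !add0r; ring.
Qed.

Definition Csmooth a := forall n, Cn n a.

Lemma Csmooth_derivable a : Csmooth a -> forall t, derivable a t 1.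
Proof. by move=> /(_ 1%N)[]. Qed.

Lemma Csmooth_derive a : Csmooth a -> Csmooth (fun t => 'D_1 a t).
Proof. by move=> sa n; have [] := sa n.+1. Qed.

Lemma Csmooth_continuous a : Csmooth a -> continuous a.
Proof.
by move=> /Csmooth_derivable da t; apply/differentiable_continuous/derivable1_diffP.
Qed.

Lemma continuous_prod3 a b c : continuous a -> continuous b -> continuous c ->
  continuous (prod3 a b c).
Proof.
move=> ca cb cc r.
have c1 : {for r, continuous (fun r : R3 R => r.1.1)}.
  by apply: (@continuous_comp _ _ _ fst fst); exact: cvg_fst.
have c2 : {for r, continuous (fun r : R3 R => r.1.2)}.
  by apply: (@continuous_comp _ _ _ fst snd); [exact: cvg_fst|exact: cvg_snd].
have c3 : {for r, continuous (fun r : R3 R => r.2)} by exact: cvg_snd.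
apply: cvgM; last exact: (continuous_comp c3 (cc _)).
by apply: cvgM; [exact: (continuous_comp c1 (ca _))|exact: (continuous_comp c2 (cb _))].
Qed.

(** Every iterated partial derivative of a separated product is again a separated product of smooth
    factors. *)
Lemma smooth_prod3 a b c : Csmooth a -> Csmooth b -> Csmooth c ->
  smooth (prod3 a b c).
Proof.
move=> sa sb sc s.
have : exists a' b' c', [/\ Csmooth a', Csmooth b', Csmooth c' &
    iter_partial s (prod3 a b c) = prod3 a' b' c'].
  elim: s => [|j s [a' [b' [c' [sa' sb' sc' IH]]]]] /=; first by exists a, b, c.
  exists (if val j == 0%N then fun t => 'D_1 a' t else a'),
    (if val j == 1%N then fun t => 'D_1 b' t else b'),
    (if val j == 2%N then fun t => 'D_1 c' t else c'); split.
  - by case: ifP => // _; exact: Csmooth_derive.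
  - by case: ifP => // _; exact: Csmooth_derive.
  - by case: ifP => // _; exact: Csmooth_derive.
  - apply/funext => r; rewrite -/(iter_partial s _) IH.
    by have [] := @derive_prod3 j a' b' c' r (Csmooth_derivable sa')
      (Csmooth_derivable sb') (Csmooth_derivable sc').
move=> [a' [b' [c' [sa' sb' sc' ->]]]]; split.
  by apply: continuous_prod3; exact: Csmooth_continuous.
move=> j r.
by have [] := @derive_prod3 j a' b' c' r (Csmooth_derivable sa')
  (Csmooth_derivable sb') (Csmooth_derivable sc').
Qed.

End separated_functions.

Section wave_packets.
Variable R : realType.
Local Notation C := R[i].
Local Notation Re := (@complex.Re R).
Local Notation Im := (@complex.Im R).
Implicit Types (nu p t E : R) (r : R3 R) (chi : 'cV[R]_(2 + 2)).

(** The sign of [nu] matters: the support lies between [nu] and [2 * nu], hence on the negative side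
    for [nu < 0]. *)
Definition scaled_bump nu t := bump (t / nu).

Definition envelope nu : R3 R -> R :=
  prod3 (scaled_bump nu) (scaled_bump nu) (scaled_bump nu).

Definition phase p r : C := cos (p * r.1.1) +i* sin (p * r.1.1).

(** A plane wave along the first axis, cut off. The spinor is real, so real and imaginary parts of
    each component are separated products. *)
Definition packet nu p chi r : 'cV[C]_4 :=
  ((envelope nu r)%:C * phase p r) *: map_mx (real_complex R) chi.

Lemma Csmooth_scaled_bump nu : Csmooth (scaled_bump nu).
Proof.
move=> n; have -> : scaled_bump nu = (fun t => bump (nu^-1 * t + 0)).
  by apply/funext => t; rewrite addr0 mulrC.
by apply: Cn_affine; exact: Cn_bump.
Qed.

Lemma derive_scaled_bump nu t : 'D_1 (scaled_bump nu) t = 'D_1 (@bump R) (t / nu) / nu.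
Proof.
have -> : scaled_bump nu = @bump R \o (fun t => nu^-1 * t + 0).
  by apply/funext => s; rewrite /= addr0 mulrC.
have db (s : R) : is_derive s 1 (@bump R) ('D_1 (@bump R) s).
  by apply/derivableP; have [] := @Cn_bump R 1.
have := @is_derive1_comp R _ (fun t => nu^-1 * t + 0) t _ _
  (db (nu^-1 * t + 0)) (is_derive_affine nu^-1 0 t).
by move=> h; rewrite derive_val addr0 [nu^-1 * t]mulrC.
Qed.

Lemma Csmooth_modulated nu p u v :
  Csmooth (fun t => scaled_bump nu t * (u * cos (p * t) + v * sin (p * t))).
Proof. by move=> n; apply: CnM; [exact: Csmooth_scaled_bump|exact: Cn_cos_sin]. Qed.

Lemma derive_modulated nu p u v t :
  'D_1 (fun t => scaled_bump nu t * (u * cos (p * t) + v * sin (p * t))) t =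
  'D_1 (scaled_bump nu) t * (u * cos (p * t) + v * sin (p * t)) +
  scaled_bump nu t * (p * (v * cos (p * t) - u * sin (p * t))).
Proof.
have db : is_derive t 1 (scaled_bump nu) ('D_1 (scaled_bump nu) t).
  by apply/derivableP; exact: (Csmooth_derivable (Csmooth_scaled_bump nu)).
have dp : is_derive t 1 (fun t => p * t) p.
  by have := is_derive_affine p 0 t; congr (is_derive _ _ _ _); apply/funext => s; rewrite addr0.
have dc : is_derive t 1 (fun t => cos (p * t)) (- sin (p * t) * p).
  exact: (@is_derive1_comp _ cos (fun t => p * t)).
have ds : is_derive t 1 (fun t => sin (p * t)) (cos (p * t) * p).
  exact: (@is_derive1_comp _ sin (fun t => p * t)).
have dcs : is_derive t 1 (fun t => u * cos (p * t) + v * sin (p * t))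
    (p * (v * cos (p * t) - u * sin (p * t))).
  by apply: is_derive_eq; rewrite /GRing.scale /=; ring.
have := is_deriveM db dcs => h.
have -> : (fun t => scaled_bump nu t * (u * cos (p * t) + v * sin (p * t))) =
  scaled_bump nu * (fun t => u * cos (p * t) + v * sin (p * t)) by [].
by rewrite derive_val /GRing.scale /=; ring.
Qed.

(** The null sine term gives real and imaginary parts the common shape treated by
    [derive_modulated]. *)
Lemma Re_packet nu p chi i : (fun r => Re (packet nu p chi r i 0)) =
  prod3 (fun t => scaled_bump nu t * (chi i 0 * cos (p * t) + 0 * sin (p * t)))
        (scaled_bump nu) (scaled_bump nu).
Proof.
by apply/funext => r; rewrite /packet /envelope /prod3 /phase !mxE /=; ring.
Qed.

Lemma Im_packet nu p chi i : (fun r => Im (packet nu p chi r i 0)) =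
  prod3 (fun t => scaled_bump nu t * (0 * cos (p * t) + chi i 0 * sin (p * t)))
        (scaled_bump nu) (scaled_bump nu).
Proof.
by apply/funext => r; rewrite /packet /envelope /prod3 /phase !mxE /=; ring.
Qed.

Definition Denvelope nu j := Dprod3 j (scaled_bump nu) (scaled_bump nu) (scaled_bump nu).

Lemma momentum_packet nu p chi j r : momentum j (packet nu p chi) r =
  ((envelope nu r * (if val j == 0%N then p else 0))%:C * phase p r) *: map_mx (real_complex R) chi +
  (- 'i%C * (Denvelope nu j r)%:C * phase p r) *: map_mx (real_complex R) chi.
Proof.
apply/colP => i; rewrite /momentum !mxE Re_packet Im_packet.
have sb := Csmooth_derivable (Csmooth_scaled_bump nu).
have sm u v := Csmooth_derivable (Csmooth_modulated nu p u v).
have [_ ->] := @derive_prod3 R j _ _ _ r (sm (chi i 0) 0) sb sb.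
have [_ ->] := @derive_prod3 R j _ _ _ r (sm 0 (chi i 0)) sb sb.
rewrite /Denvelope /Dprod3 /prod3 /envelope /prod3 /phase.
case: r => -[x y] z; case: j => -[|[|[|//]]] j3 /=;
  rewrite ?derive_modulated; apply/eqP; rewrite eq_complex /=; apply/andP; split; apply/eqP; ring.
Qed.

(** The hypothesis says that [chi] is the spinor of a free plane wave of energy [E]; its
    contribution cancels, leaving derivatives of the cut-off and the potential. *)
Lemma dirac_op_packet m k nu p chi E r :
  p%:C *: (dirac_alpha R ord0 *m map_mx (real_complex R) chi) +
  m%:C *: (dirac_beta R *m map_mx (real_complex R) chi) =
    E%:C *: map_mx (real_complex R) chi ->
  dirac_op m k (packet nu p chi) r - E%:C *: packet nu p chi r =
  \sum_(j < 3) (- 'i%C * (Denvelope nu j r)%:C * phase p r) *: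
     (dirac_alpha R j *m map_mx (real_complex R) chi)
  - (k / euclid r)%:C *: packet nu p chi r.
Proof.
have rearrange (V : zmodType) (a b c d : V) : a + b + c - d - (a + c) = b - d.
  by rewrite [a + b]addrC -[b + a + c]addrA [b + (a + c) - d]addrAC addrK.
set X := map_mx _ _ => eig; rewrite /dirac_op.
under eq_bigr => j _ do rewrite momentum_packet mulmxDr -!scalemxAr.
rewrite big_split /=.
have -> : \sum_(j < 3) ((envelope nu r * (if val j == 0%N then p else 0))%:C * phase p r) *:
    (dirac_alpha R j *m X) = ((envelope nu r)%:C * phase p r) *: (p%:C *: (dirac_alpha R ord0 *m X)).
  rewrite big_ord_recl /= big1 ?addr0.
    by rewrite scalerA rmorphM/= mulrAC.
  by move=> j _; rewrite mulr0 mul0r scale0r.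
rewrite /packet -/X; set A := _ * phase p r.
rewrite -[dirac_beta R *m (A *: X)]scalemxAr.
have -> : E%:C *: (A *: X) = A *: (p%:C *: (dirac_alpha R ord0 *m X)) + m%:C *: (A *: (dirac_beta R *m X)).
  by rewrite scalerA [_ * A]mulrC -scalerA -eig scalerDr !scalerA [m%:C * A]mulrC.
exact: rearrange.
Qed.

Definition support_box nu r :=
  [&& 1 < r.1.1 / nu < 2, 1 < r.1.2 / nu < 2 & 1 < r.2 / nu < 2].

Lemma support_le nu t : nu != 0 -> 1 < t / nu < 2 -> `|t| <= 2 * `|nu|.
Proof.
move=> nu0 /andP[t1 t2]; have n0 : 0 < `|nu| by rewrite normr_gt0.
rewrite -ler_pdivrMr// -normfV -normrM.
by rewrite ger0_norm ?(ltW t2)// (le_trans ler01)// ltW.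
Qed.

Lemma envelope_outside nu r : ~~ support_box nu r ->
  envelope nu r = 0 /\ forall j, Denvelope nu j r = 0.
Proof.
have D0 t : ~~ (1 < t / nu < 2) ->
    scaled_bump nu t = 0 /\ 'D_1 (scaled_bump nu) t = 0.
  by move=> /bump_outside[b0 d0]; rewrite derive_scaled_bump d0 mul0r.
rewrite /envelope /Denvelope /Dprod3 /prod3 /support_box.
have [h1|h1] := boolP (1 < r.1.1 / nu < 2); last first.
  have [b0 d0] := D0 _ h1.
  by rewrite b0 !mul0r; split => // j; case: ifP => _; rewrite ?b0 ?d0 !mul0r.
have [h2|h2] := boolP (1 < r.1.2 / nu < 2); last first.
  have [b0 d0] := D0 _ h2.
  by rewrite b0 !mulr0 mul0r; split => // j; case: (val j == 1%N); rewrite ?b0 ?d0 mulr0 mul0r.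
move=> /= /D0[b0 d0].
by rewrite b0 !mulr0; split => // j; case: (val j == 2%N); rewrite ?b0 ?d0 mulr0.
Qed.

Lemma scaled_bump_bounds nu t : 0 <= scaled_bump nu t <= 1.
Proof. by rewrite bump_ge0 bump_le1. Qed.

Lemma envelope_bounds nu r : 0 <= envelope nu r <= 1.
Proof.
have /andP[a0 a1] := scaled_bump_bounds nu r.1.1.
have /andP[b0 b1] := scaled_bump_bounds nu r.1.2.
have /andP[c0 c1] := scaled_bump_bounds nu r.2.
rewrite /envelope /prod3; apply/andP; split.
  by apply: mulr_ge0 => //; exact: mulr_ge0.
by apply: mulr_ile1 => //; [exact: mulr_ge0|exact: mulr_ile1].
Qed.

Lemma Denvelope_le nu j r : `|Denvelope nu j r| <= 48 / `|nu|.
Proof.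
have b t : `|scaled_bump nu t| <= 1.
  by have /andP[? ?] := scaled_bump_bounds nu t; rewrite ger0_norm.
have d t : `|'D_1 (scaled_bump nu) t| <= 48 / `|nu|.
  rewrite derive_scaled_bump normrM normfV ler_wpM2r ?invr_ge0//.
  exact: derive_bump_le.
have n0 : 0 <= 48 / `|nu| by rewrite divr_ge0.
rewrite /Denvelope /Dprod3 /prod3 !normrM; case: j => -[|[|[|//]]] j3 /=.
- by rewrite -mulrA -[_ / _]mulr1; apply: ler_pM => //; rewrite mulr_ile1.
- by rewrite mulrAC mulrC -[_ / _]mulr1; apply: ler_pM => //; rewrite mulr_ile1.
- by rewrite mulrC -[_ / _]mulr1; apply: ler_pM => //; rewrite mulr_ile1.
Qed.

Lemma normc_phase p r : normc (phase p r) = 1.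
Proof. by rewrite /= cos2Dsin2 sqrtr1. Qed.

Lemma normc_real (a : R) : normc a%:C = `|a|.
Proof. by rewrite /= expr0n addr0 sqrtr_sqr. Qed.

Lemma normc_ge0 (z : C) : 0 <= normc z. Proof. by case: z => a b; exact: sqrtr_ge0. Qed.

Lemma euclid_ge r : `|r.1.1| <= euclid r.
Proof.
rewrite /euclid -sqrtr_sqr ler_sqrt; last by rewrite !addr_ge0 ?sqr_ge0.
by rewrite -addrA lerDl addr_ge0 ?sqr_ge0.
Qed.

Lemma packet_le nu p chi r i : normc (packet nu p chi r i 0) <= `|chi i 0|.
Proof.
rewrite /packet !mxE !normcM normc_phase mulr1 !normc_real.
have /andP[e0 e1] := envelope_bounds nu r.
by rewrite (ger0_norm e0) ler_piMl.
Qed.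

Lemma packet_outside nu p chi r : ~~ support_box nu r -> packet nu p chi r = 0.
Proof. by move=> /envelope_outside[e0 _]; rewrite /packet e0 mul0r scale0r. Qed.

(* On the support of a packet [euclid r >= `|nu|], so the potential is as small
   as the derivative of the envelope. *)
Lemma packet_residual m k p chi E :
  p%:C *: (dirac_alpha R ord0 *m map_mx (real_complex R) chi) +
  m%:C *: (dirac_beta R *m map_mx (real_complex R) chi) =
    E%:C *: map_mx (real_complex R) chi ->
  exists2 K, 0 <= K & forall nu r i, nu != 0 ->
    normc ((dirac_op m k (packet nu p chi) r - E%:C *: packet nu p chi r) i 0)
      <= (if support_box nu r then K / `|nu| else 0).
Proof.
move=> eig; pose X := map_mx (real_complex R) chi.
pose A i j := normc ((dirac_alpha R j *m X) i 0).
(* 48 bounds the derivative of the bump; the last term is the nuclear potential, at most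
   [|k| / |nu|] on the support. *)
pose Ki i := \sum_(j < 3) 48 * A i j + `|k| * `|chi i 0|.
have Ki0 i : 0 <= Ki i.
  rewrite addr_ge0 ?mulr_ge0// sumr_ge0// => j _.
  by rewrite mulr_ge0// normc_ge0.
exists (\sum_i Ki i); first exact: sumr_ge0.
move=> nu r i nu0; rewrite (dirac_op_packet k nu r eig).
case: ifPn => [supp|nsupp]; last first.
  have [e0 d0] := envelope_outside nsupp.
  rewrite packet_outside// scaler0 subr0 big1 ?mxE ?normc0// => j _.
  by rewrite d0 mulr0 mul0r scale0r.
have n0 : 0 < `|nu| by rewrite normr_gt0.
apply: (@le_trans _ _ (Ki i / `|nu|)); last first.
  by rewrite ler_wpM2r ?invr_ge0// (bigD1 i)//= lerDl sumr_ge0.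
rewrite mxE summxE /Ki mulrDl mulr_suml.
apply: le_trans (le_normcD _ _) _; apply: lerD.
  have normc_sum (F : 'I_3 -> C) : normc (\sum_j F j) <= \sum_j normc (F j).
    by elim/big_rec2: _ => [|j x y _ h]; [rewrite normc0|apply: le_trans (le_normcD _ _) _; rewrite lerD2l].
  apply: le_trans (normc_sum _) _; apply: ler_sum => j _.
  rewrite mxE !normcM normc_phase mulr1 normcN normc_real.
  have -> : normc 'i%C = 1 :> R by rewrite /= expr0n expr1n add0r sqrtr1.
  rewrite mul1r [X in _ <= X]mulrAC; apply: ler_wpM2r; first exact: normc_ge0.
  exact: Denvelope_le.
rewrite !mxE normcN !normcM normc_real normc_phase mulr1 normc_real normc_real.
have /andP[e0 e1] := envelope_bounds nu r; rewrite (ger0_norm e0).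
have le_nu : `|nu| <= `|euclid r|.
  rewrite [X in _ <= X]ger0_norm ?sqrtr_ge0//; apply: le_trans (euclid_ge r).
  case/and3P: supp => /andP[x1 _] _ _.
  have : 1 <= `|r.1.1 / nu| by apply: le_trans (ltW x1) (ler_norm _).
  by rewrite normrM normfV ler_pdivlMr// mul1r.
have iE : `|euclid r|^-1 <= `|nu|^-1 by rewrite lef_pV2 ?posrE// (lt_le_trans n0).
have -> : `|k| * `|chi i 0| / `|nu| = (`|k| / `|nu|) * (1 * `|chi i 0|).
  by rewrite mul1r mulrAC.
rewrite normrM normfV; apply: ler_pM.
- by rewrite mulr_ge0// invr_ge0.
- exact: mulr_ge0.
- exact: ler_wpM2l.
- exact: ler_wpM2r.
Qed.

Lemma compact_box (a : R) : compact [set r : R3 R | `|r.1.1| <= a /\ `|r.1.2| <= a /\ `|r.2| <= a].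
Proof.
have -> : [set r : R3 R | `|r.1.1| <= a /\ `|r.1.2| <= a /\ `|r.2| <= a] =
    (`[- a, a] `*` `[- a, a]) `*` `[- a, a].
  apply/seteqP; split=> -[[x y] z] /=; rewrite !in_itv/= !ler_norml.
    by move=> [? []].
  by move=> [[? ?] ?].
by apply: compact_setX; [apply: compact_setX|]; exact: segment_compact.
Qed.

Lemma test_function_packet nu p chi : nu != 0 -> test_function (packet nu p chi).
Proof.
move=> nu0; have sb := Csmooth_scaled_bump nu.
split=> [i|].
  by split; rewrite ?Re_packet ?Im_packet; apply: smooth_prod3 => //; exact: Csmooth_modulated.
pose K := [set r : R3 R | `|r.1.1| <= 2 * `|nu| /\ `|r.1.2| <= 2 * `|nu| /\ `|r.2| <= 2 * `|nu|].
have cK : closed K by apply: compact_closed; [exact: norm_hausdorff|exact: compact_box].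
apply: (@subclosed_compact _ _ K); first exact: closed_closure.
  exact: compact_box.
have -> : K = closure K by exact/closure_id.
apply: closure_subset => r /= rN0.
have : support_box nu r.
  by apply: contraNT rN0 => /packet_outside ->.
by move=> /and3P[/(support_le nu0) ? /(support_le nu0) ? /(support_le nu0) ?].
Qed.

(* The spinor (1, 0, 0, q) with p = (E + m) q and q ^ 2 = (E - m) / (E + m). *)
Lemma plane_wave_spinor m E : `|m| < `|E| -> exists p chi,
  [/\ p%:C *: (dirac_alpha R ord0 *m map_mx (real_complex R) chi) +
  m%:C *: (dirac_beta R *m map_mx (real_complex R) chi) =
    E%:C *: map_mx (real_complex R) chi & chi ord0 0 = 1].
Proof.
move=> mE.
have mE2 : m ^+ 2 < E ^+ 2.
  by rewrite -(real_normK (num_real m)) -(real_normK (num_real E)) ltr_sqr ?nnegrE.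
have Em : E + m != 0.
  by apply: contraTneq mE2 => /eqP; rewrite addr_eq0 => /eqP ->; rewrite sqrrN ltxx.
have q0 : 0 <= (E - m) / (E + m).
  have -> : (E - m) / (E + m) = (E ^+ 2 - m ^+ 2) / (E + m) ^+ 2 by field.
  by rewrite divr_ge0 ?sqr_ge0// subr_ge0 ltW.
pose q := Num.sqrt ((E - m) / (E + m)).
have qE : (E + m) * q ^+ 2 = E - m by rewrite sqr_sqrtr//; field.
pose up : 'cV[R]_2 := \col_i (i == 0)%:R.
pose dn : 'cV[R]_2 := \col_i (q * (i == 1)%:R).
exists ((E + m) * q), (col_mx up dn); split; last first.
  have -> : ord0 = lshift 2 (ord0 : 'I_2) by apply/val_inj.
  by rewrite col_mxEu mxE.
rewrite map_col_mx /dirac_alpha /dirac_beta !mul_block_col.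
rewrite !mul0mx !add0r !addr0 mulNmx !mul1mx !scale_col_mx add_col_mx.
congr col_mx; apply/colP => i; rewrite !mxE !big_ord_recl !big_ord0 /pauli /= !mxE /=;
  case: i => -[|[|//]] i2 /=; apply/eqP; rewrite eq_complex /=; apply/andP; split; apply/eqP;
  rewrite ?(mulr0, mul0r, mulr1, mul1r, addr0, add0r, subr0, oppr0)//;
  move: qE; rewrite expr2 => qE; lra.
Qed.

End wave_packets.

(** * Products of two packets *)

Section indicator.
Context d (T : measurableType d) (R : realType).
Variables (mu : {measure set T -> \bar R}) (Q : set T).
Hypotheses (mQ : measurable Q) (Qoo : (mu Q < +oo)%E).

Lemma integrable_scaled_indic (c : R) :
  mu.-integrable setT (EFin \o (fun x : T => c * \1_Q x)).
Proof.
have iQ : mu.-integrable setT (EFin \o (\1_Q : T -> R)).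
  apply/integrableP; split; first by apply/measurable_EFinP; exact: measurable_indic.
  under eq_integral do rewrite /= ger0_norm//.
  by rewrite integral_indic// setIT.
by have := integrableZl measurableT c iQ; congr (integrable _ _ _); apply/funext.
Qed.

Lemma Rintegral_scaled_indic (c : R) :
  \int[mu]_x (c * \1_Q x) = c * fine (mu Q).
Proof.
have iQ := integrable_scaled_indic 1.
have {}iQ : mu.-integrable setT (EFin \o (\1_Q : T -> R)).
  by move: iQ; congr (integrable _ _ _); apply/funext => x /=; rewrite mul1r.
by rewrite RintegralZl// /Rintegral integral_indic// setIT.
Qed.

Lemma Lfun2_bounded_support (f : T -> R) (c : R) : measurable_fun setT f ->
  (forall x, `|f x| <= c * \1_Q x) -> f \in Lfun mu 2%:E.
Proof.
move=> mf fc; apply: (@Lfun2_dominated _ _ _ _ _ (fun x => c * \1_Q x)) => //.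
  apply/Lfun2P; split.
    by apply: measurable_funM => //; exact: measurable_indic.
  have := integrable_scaled_indic (c ^+ 2); congr (integrable _ _ _).
  apply/funext => x /=; congr (_%:E); rewrite exprMn /indic.
  by case: (x \in Q); rewrite ?expr1n ?expr0n.
by move=> x; apply: le_trans (fc x) (ler_norm _).
Qed.

End indicator.

Section tensor_products.
Variable R : realType.
Local Notation C := R[i].
Local Notation Re := (@complex.Re R).
Local Notation Im := (@complex.Im R).
Local Notation mR := (measurableTypeR R).
Local Notation mR3 := (mR * mR * mR)%type.
Local Notation mR6 := (mR3 * mR3)%type.

Lemma kron2E (u v : 'cV[C]_2) i j : kron2 u v (Mat_index i j) 0 = u j 0 * v i 0.
Proof.
have -> : Mat_index i j = if val j == 0%N then lshift 2 i else rshift 2 i.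
  by apply/val_inj; case: j => -[|[|//]] ? /=; case: i => -[|[|//]] ? /=; rewrite inordK.
case: j => -[|[|//]] j2 /=; rewrite /kron2 ?col_mxEu ?col_mxEd mxE;
  by congr (u _ _ * _); apply/val_inj.
Qed.

Lemma kron4_exchanged (u v : 'cV[C]_(2 + 2)) s t : exchanged s t ->
  kron4 u v s 0 = kron4 v u t 0.
Proof.
have E11 (a b c d : 'cV[C]_4) t0 : col_mx (col_mx a b) (col_mx c d) (lshift _ (lshift _ t0)) 0 = a t0 0.
  by rewrite !col_mxEu.
have E12 (a b c d : 'cV[C]_4) t0 : col_mx (col_mx a b) (col_mx c d) (lshift _ (rshift _ t0)) 0 = b t0 0.
  by rewrite col_mxEu col_mxEd.
have E21 (a b c d : 'cV[C]_4) t0 : col_mx (col_mx a b) (col_mx c d) (rshift _ (lshift _ t0)) 0 = c t0 0.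
  by rewrite col_mxEd col_mxEu.
have E22 (a b c d : 'cV[C]_4) t0 : col_mx (col_mx a b) (col_mx c d) (rshift _ (rshift _ t0)) 0 = d t0 0.
  by rewrite !col_mxEd.
case=> i j; rewrite /kron4.
- by rewrite [LHS]E11 [RHS]E11 [LHS]kron2E [RHS]kron2E mulrC.
- by rewrite [LHS]E22 [RHS]E22 [LHS]kron2E [RHS]kron2E mulrC.
- by rewrite [LHS]E12 [RHS]E21 [LHS]kron2E [RHS]kron2E mulrC.
Qed.

(** The index pair is fixed before [u] and [v], so one choice turns every tensor in an expression
    into a product of scalars. *)
Lemma kron4E s : exists st : 'I_4 * 'I_4, forall u v : 'cV[C]_(2 + 2),
  kron4 u v s 0 = u st.1 0 * v st.2 0.
Proof.
have k2 (t : 'I_(2 + 2)) : exists st : 'I_2 * 'I_2, forall u v : 'cV[C]_2,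
    kron2 u v t 0 = u st.1 0 * v st.2 0.
  by case: (split_ordP t) => i ->; [exists (0, i)|exists (1, i)] => u v;
    rewrite /kron2 ?col_mxEu ?col_mxEd mxE.
case: (split_ordP s) => s' ->; case: (split_ordP s') => t ->; have [[i j] ij] := k2 t.
- by exists (lshift 2 i, lshift 2 j) => u v; rewrite /kron4 !col_mxEu ij !mxE.
- by exists (lshift 2 i, rshift 2 j) => u v; rewrite /kron4 col_mxEu col_mxEd ij !mxE.
- by exists (rshift 2 i, lshift 2 j) => u v; rewrite /kron4 col_mxEd col_mxEu ij !mxE.
- by exists (rshift 2 i, rshift 2 j) => u v; rewrite /kron4 !col_mxEd ij !mxE.
Qed.

Definition cube (a b : R) : set mR3 := (`[a, b] `*` `[a, b]) `*` `[a, b].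

Lemma measurable_cube a b : measurable (cube a b).
Proof. by apply: measurableX; [apply: measurableX|]. Qed.

Lemma leb2X (A B : set mR) : measurable A -> measurable B ->
  leb2 (A `*` B) = (lebesgue_measure A * lebesgue_measure B)%E.
Proof. exact: product_measure1E. Qed.

Lemma leb3X (A : set (mR * mR)) (B : set mR) : measurable A -> measurable B ->
  leb3 (A `*` B) = (leb2 A * lebesgue_measure B)%E.
Proof. exact: product_measure1E. Qed.

Lemma leb6X (A B : set mR3) : measurable A -> measurable B ->
  leb6 (A `*` B) = (leb3 A * leb3 B)%E.
Proof. exact: product_measure1E. Qed.

Lemma leb3_cube a b : a <= b -> leb3 (cube a b) = ((b - a) ^+ 3)%:E.
Proof.
move=> ab.
have len : lebesgue_measure (`[a, b]%classic : set mR) = (b - a)%:E.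
  rewrite lebesgue_measure_itv/= lte_fin; case: ltgtP ab => // -> _.
  by rewrite subrr.
have mI : measurable (`[a, b]%classic : set mR) by exact: measurable_itv.
rewrite /cube (leb3X (measurableX mI mI) mI) (leb2X mI mI) len -!EFinM.
by rewrite -expr2 -exprSr.
Qed.

Lemma leb6_cubes a b c d : a <= b -> c <= d ->
  leb6 (cube a b `*` cube c d) = ((b - a) ^+ 3 * (d - c) ^+ 3)%:E.
Proof.
move=> ab cd; rewrite (leb6X (measurable_cube _ _) (measurable_cube _ _)).
by rewrite (leb3_cube ab) (leb3_cube cd) -EFinM.
Qed.

Section support.
Variable Q : set mR6.
Hypotheses (mQ : measurable Q) (Qoo : (leb6 Q < +oo)%E).

Lemma normc_sqr (z : C) : normc z ^+ 2 = Re z * Re z + Im z * Im z.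
Proof. by case: z => a b; rewrite /= sqr_sqrtr ?addr_ge0 ?sqr_ge0// !expr2. Qed.

Lemma L2norm_le_support (v : wavefun R) (c : R) : square_integrable v -> 0 <= c ->
  (forall x i, normc (v x i 0) <= c * \1_Q x) ->
  L2norm v ^+ 2 <= 16 * (c ^+ 2 * fine (leb6 Q)).
Proof.
move=> v2 c0 vc; rewrite L2norm_sqr rinnerE.
apply: (@le_trans _ _ (\sum_(i < (4 + 4) + (4 + 4)) c ^+ 2 * fine (leb6 Q))); last first.
  by rewrite sumr_const card_ord mulr_natl.
apply: ler_sum => i _; rewrite -(Rintegral_scaled_indic mQ Qoo).
apply: le_Rintegral; [exact: measurableT|exact: integrable_rinner|exact: integrable_scaled_indic mQ Qoo _|].
move=> x _; rewrite -normc_sqr.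
have -> : c ^+ 2 * \1_Q x = (c * \1_Q x) ^+ 2.
  by rewrite exprMn /indic; case: (x \in Q); rewrite ?expr1n ?expr0n.
by rewrite ler_sqr ?nnegrE ?mulr_ge0 ?normc_ge0.
Qed.

Lemma L2norm_ge_support (v : wavefun R) (c : R) i : square_integrable v -> 0 <= c ->
  (forall x, Q x -> c <= normc (v x i 0)) ->
  c ^+ 2 * fine (leb6 Q) <= L2norm v ^+ 2.
Proof.
move=> v2 c0 vc; rewrite L2norm_sqr rinnerE (bigD1 i)//=.
apply: ler_wpDr.
  apply: sumr_ge0 => j _; apply: Rintegral_ge0 => x _.
  by rewrite -normc_sqr sqr_ge0.
rewrite -(Rintegral_scaled_indic mQ Qoo).
apply: le_Rintegral; [exact: measurableT|exact: integrable_scaled_indic mQ Qoo _|exact: integrable_rinner|].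
move=> x _; rewrite -normc_sqr /indic.
have [/set_mem Qx|_] := boolP (x \in Q); last by rewrite mulr0 sqr_ge0.
by rewrite mulr1 ler_sqr ?nnegrE ?normc_ge0//; exact: vc.
Qed.

End support.

Lemma measurable_prod3 (a b c : R -> R) : continuous a -> continuous b ->
  continuous c -> measurable_fun setT (prod3 a b c : mR3 -> R).
Proof.
move=> ca cb cc.
have ma := continuous_measurable_fun ca.
have mb := continuous_measurable_fun cb.
have mc := continuous_measurable_fun cc.
apply: measurable_funM.
  apply: measurable_funM.
    by apply: (measurableT_comp ma); apply: (measurableT_comp measurable_fst measurable_fst).
  by apply: (measurableT_comp mb); apply: (measurableT_comp measurable_snd measurable_fst).
by apply: (measurableT_comp mc); exact: measurable_snd.
Qed.

Lemma measurable_packet (nu p : R) chi i :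
  measurable_fun setT ((fun r => Re (packet nu p chi r i 0)) : mR3 -> R) /\
  measurable_fun setT ((fun r => Im (packet nu p chi r i 0)) : mR3 -> R).
Proof.
have cb := Csmooth_continuous (@Csmooth_scaled_bump R nu).
by split; rewrite ?Re_packet ?Im_packet; apply: measurable_prod3 => //;
  apply: Csmooth_continuous; exact: Csmooth_modulated.
Qed.

(** Symmetric about the origin, so that the same set contains the supports for [nu] and for [- nu],
    in either order of the particles. *)
Definition support_cubes (nu : R) : set mR6 :=
  cube (- (2 * `|nu|)) (2 * `|nu|) `*` cube (- (2 * `|nu|)) (2 * `|nu|).

Lemma support_box_cube (nu : R) r : nu != 0 -> support_box nu r ->
  cube (- (2 * `|nu|)) (2 * `|nu|) r.
Proof.
move=> nu0.
have H x : 1 < x / nu < 2 -> - (2 * `|nu|) <= x <= 2 * `|nu|.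
  by rewrite -ler_norml; exact: support_le.
by move=> /and3P[/H ? /H ? /H ?]; rewrite /cube /= !in_itv.
Qed.

Lemma square_integrable_tensor (nu p nu' p' : R) chi chi' : nu != 0 -> `|nu'| = `|nu| ->
  square_integrable (tensor (packet nu p chi) (packet nu' p' chi')).
Proof.
move=> nu0 nuE s; have [[i j] /= ij] := kron4E s.
have nu'0 : nu' != 0 by rewrite -normr_eq0 nuE normr_eq0.
have mQ : measurable (support_cubes nu).
  by apply: measurableX; exact: measurable_cube.
have Qoo : (leb6 (support_cubes nu) < +oo)%E.
  by rewrite leb6_cubes ?ltry// lerNl -subr_ge0 opprK addr_ge0 ?mulr_ge0.
have [m1 m2] := measurable_packet nu p chi i.
have [m3 m4] := measurable_packet nu' p' chi' j.
have m1' := measurableT_comp m1 (@measurable_fst _ _ mR3 mR3).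
have m2' := measurableT_comp m2 (@measurable_fst _ _ mR3 mR3).
have m3' := measurableT_comp m3 (@measurable_snd _ _ mR3 mR3).
have m4' := measurableT_comp m4 (@measurable_snd _ _ mR3 mR3).
have bound x : normc (tensor (packet nu p chi) (packet nu' p' chi') x s 0) <=
    (`|chi i 0| * `|chi' j 0|) * \1_(support_cubes nu) x.
  rewrite /tensor ij normcM.
  have [s1|/packet_outside ->] := boolP (support_box nu x.1); last first.
    by rewrite mxE normc0 mul0r !mulr_ge0.
  have [s2|/packet_outside ->] := boolP (support_box nu' x.2); last first.
    by rewrite [X in _ * normc X]mxE normc0 mulr0 !mulr_ge0.
  rewrite /indic mem_set ?mulr1; first by apply: ler_pM; rewrite ?normc_ge0 ?packet_le.
  split; first exact: support_box_cube.
  by rewrite -nuE; exact: support_box_cube.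
have Rec (z : C) : `|Re z| <= normc z /\ `|Im z| <= normc z.
  case: z => a b /=; split; rewrite -sqrtr_sqr ler_sqrt ?addr_ge0 ?sqr_ge0//.
    by rewrite lerDl sqr_ge0.
  by rewrite lerDr sqr_ge0.
split.
- apply: (Lfun2_bounded_support mQ Qoo) => [|x]; last exact: le_trans (Rec _).1 (bound x).
  under eq_fun do rewrite /tensor ij ReM.
  by apply: measurable_funB; exact: measurable_funM.
- apply: (Lfun2_bounded_support mQ Qoo) => [|x]; last exact: le_trans (Rec _).2 (bound x).
  under eq_fun do rewrite /tensor ij ImM.
  by apply: measurable_funD; exact: measurable_funM.
Qed.

(** Energies add under the tensor product, so the residual is that of each packet times the other
    packet, plus the repulsion term; each is O(1 / [|nu|]), with [K] independent of [nu]. *)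
Lemma pair_residual (m k k0 p p' E E' : R) chi chi' :
  p%:C *: (dirac_alpha R ord0 *m map_mx (real_complex R) chi) +
  m%:C *: (dirac_beta R *m map_mx (real_complex R) chi) =
    E%:C *: map_mx (real_complex R) chi ->
  p'%:C *: (dirac_alpha R ord0 *m map_mx (real_complex R) chi') +
  m%:C *: (dirac_beta R *m map_mx (real_complex R) chi') =
    E'%:C *: map_mx (real_complex R) chi' ->
  exists2 K, 0 <= K & forall nu f g x s, nu != 0 ->
    f = packet nu p chi -> g = packet (- nu) p' chi' ->
    normc ((tensor (dirac_op m k f) g x + tensor f (dirac_op m k g) x +
            (k0 / euclid (x.1 - x.2))%:C *: tensor f g x -
            (E + E')%:C *: tensor f g x) s 0)
      <= K / `|nu| * \1_(support_cubes nu) x.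
Proof.
move=> eig eig'.
have [K1 K10 K1P] := packet_residual k eig.
have [K2 K20 K2P] := packet_residual k eig'.
pose X := \sum_i `|chi i 0|; pose X' := \sum_i `|chi' i 0|.
have X0 : 0 <= X by exact: sumr_ge0.
have X'0 : 0 <= X' by exact: sumr_ge0.
have Xi i : `|chi i 0| <= X by rewrite /X (bigD1 i)//= lerDl sumr_ge0.
have X'i i : `|chi' i 0| <= X' by rewrite /X' (bigD1 i)//= lerDl sumr_ge0.
exists (K1 * X' + X * K2 + `|k0| * (X * X')).
  by rewrite !addr_ge0 ?mulr_ge0.
move=> nu f g x s nu0 fE gE.
have [[i j] /= ij] := kron4E s.
have n0 : 0 < `|nu| by rewrite normr_gt0.
have nuN0 : - nu != 0 by rewrite oppr_eq0.
set rf := dirac_op m k f x.1 - E%:C *: f x.1.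
set rg := dirac_op m k g x.2 - E'%:C *: g x.2.
have -> : (tensor (dirac_op m k f) g x + tensor f (dirac_op m k g) x +
    (k0 / euclid (x.1 - x.2))%:C *: tensor f g x - (E + E')%:C *: tensor f g x) s 0 =
    rf i 0 * g x.2 j 0 + f x.1 i 0 * rg j 0 +
    (k0 / euclid (x.1 - x.2))%:C * (f x.1 i 0 * g x.2 j 0).
  have lin (u v w : C16 R) (c e : C) :
      (u + v + c *: w - e *: w) s 0 = u s 0 + v s 0 + c * w s 0 - e * w s 0.
    by rewrite !mxE.
  have lin4 (v w : 'cV[C]_4) (c : C) t : (v - c *: w) t 0 = v t 0 - c * w t 0.
    by rewrite !mxE.
  have tE u v : tensor u v x s 0 = u x.1 i 0 * v x.2 j 0 by exact: ij.
  have arith (a b c d e e' v : C) : a * d + c * b + v * (c * d) - (e + e') * (c * d) =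
      (a - e * c) * d + c * (b - e' * d) + v * (c * d) by ring.
  rewrite lin tE tE tE [rf i 0]lin4 [rg j 0]lin4 rmorphD.
  exact: arith.
have rfP := K1P nu x.1 i nu0; have rgP := K2P (- nu) x.2 j nuN0.
rewrite -fE -/rf in rfP; rewrite -gE -/rg normrN in rgP.
(* Off its support a packet vanishes together with its residual, which kills all three terms. *)
have [s1|n1] := boolP (support_box nu x.1); last first.
  rewrite (negbTE n1) in rfP.
  have rf0 : rf i 0 = 0 by apply: eq0_normc; apply/eqP; rewrite eq_le rfP normc_ge0.
  have f0 : f x.1 i 0 = 0 by rewrite fE packet_outside// mxE.
  by rewrite rf0 f0 !mul0r mulr0 !addr0 normc0 !mulr_ge0 ?invr_ge0// !addr_ge0 ?mulr_ge0.
have [s2|n2] := boolP (support_box (- nu) x.2); last first.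
  rewrite (negbTE n2) in rgP.
  have rg0 : rg j 0 = 0 by apply: eq0_normc; apply/eqP; rewrite eq_le rgP normc_ge0.
  have g0 : g x.2 j 0 = 0 by rewrite gE packet_outside// mxE.
  by rewrite rg0 g0 !mulr0 !addr0 normc0 !mulr_ge0 ?invr_ge0// !addr_ge0 ?mulr_ge0.
rewrite /indic mem_set; last first.
  split; first exact: support_box_cube.
  by rewrite -normrN; exact: support_box_cube.
rewrite s1 in rfP; rewrite s2 in rgP; rewrite mulr1 !mulrDl.
have fX : normc (f x.1 i 0) <= X by rewrite fE; apply: le_trans (packet_le _ _ _ _ _) (Xi i).
have gX : normc (g x.2 j 0) <= X' by rewrite gE; apply: le_trans (packet_le _ _ _ _ _) (X'i j).
apply: le_trans (le_normcD _ _) _; apply: lerD.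
  apply: le_trans (le_normcD _ _) _; rewrite !normcM; apply: lerD.
    by rewrite mulrAC; apply: ler_pM; rewrite ?normc_ge0.
  by rewrite -mulrA; apply: ler_pM; rewrite ?normc_ge0.
rewrite !normcM normc_real normrM normfV.
have -> : `|k0| * (X * X') / `|nu| = (`|k0| / `|nu|) * (X * X') by rewrite mulrAC.
apply: ler_pM.
- by rewrite mulr_ge0// invr_ge0.
- by rewrite mulr_ge0// normc_ge0.
- apply: ler_wpM2l => //.
  (* After division by [nu] the first coordinates exceed 1 and lie below -1 respectively. *)
  have h : `|nu| <= euclid (x.1 - x.2).
    apply: le_trans (euclid_ge _).
    have /andP[a1 _] : 1 < x.1.1.1 / nu < 2 by case/and3P: s1.
    have /andP[b1 _] : 1 < x.2.1.1 / - nu < 2 by case/and3P: s2.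
    have : 1 <= `|(x.1 - x.2).1.1 / nu|.
      apply: le_trans (ler_norm _).
      rewrite /= mulrDl mulNr; move: b1; rewrite invrN mulrN => b1.
      by move: (_ / nu) (_ / nu) a1 b1 => ? ?; lra.
    by rewrite normrM normfV ler_pdivlMr// mul1r.
  rewrite [`|euclid _|]ger0_norm ?sqrtr_ge0//.
  by rewrite lef_pV2 ?posrE// (lt_le_trans n0).
- by apply: ler_pM; rewrite ?normc_ge0.
Qed.

End tensor_products.

(** * Approximate eigenvectors *)

Section approximate_eigenvectors.
Variable R : realType.
Local Notation C := R[i].
Local Notation F := (wavefun R).
Local Notation mR := (measurableTypeR R).
Local Notation mR3 := (mR * mR * mR)%type.
Local Notation mR6 := (mR3 * mR3)%type.

Lemma entryD (A B : C16 R) t : (A + B) t 0 = A t 0 + B t 0.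
Proof. by rewrite mxE. Qed.

Lemma packetN (nu p : R) chi r : packet nu p (- chi) r = - packet nu p chi r.
Proof. by rewrite /packet map_mxN scalerN. Qed.

(* The Slater determinant of two packets sitting at opposite ends of an axis. *)
Definition slater (nu p1 p2 : R) chi1 chi2 : F := fun x =>
  tensor (packet nu p1 chi1) (packet (- nu) p2 chi2) x +
  tensor (packet (- nu) p2 (- chi2)) (packet nu p1 chi1) x.

Lemma slater_HA2 nu p1 p2 chi1 chi2 : nu != 0 -> HA2 (slater nu p1 p2 chi1 chi2).
Proof.
move=> nu0; split.
  rewrite -[slater _ _ _ _ _]/(tensor (packet nu p1 chi1) (packet (- nu) p2 chi2) +
    tensor (packet (- nu) p2 (- chi2)) (packet nu p1 chi1)) -[X in X + _]scale1r.
  by apply: square_integrable_linear; apply: square_integrable_tensor; rewrite ?oppr_eq0 ?normrN.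
apply/exchange_antisymmetricP; apply: nearW => x s t st.
have [[i j] /= ij] := kron4E R t.
(* Exchange turns each of the two tensors into the opposite of the other one. *)
have swap (u v u' v' : 'cV[C]_(2 + 2)) : (kron4 u v + kron4 (- v') u') s 0 =
    - (kron4 u' v' + kron4 (- v) u) t 0.
  have sE (a b : 'cV[C]_(2 + 2)) : kron4 a b s 0 = b i 0 * a j 0.
    exact: etrans (kron4_exchanged a b st) (ij b a).
  apply: etrans (etrans (entryD _ _ _) (congr2 +%R (sE u v) (sE (- v') u'))) _.
  apply: etrans _ (congr1 -%R (esym (etrans (entryD _ _ _)
    (congr2 +%R (ij u' v') (ij (- v) u))))).
  by rewrite [(- v') _ _]mxE [(- v) _ _]mxE; ring.
have := swap (packet nu p1 chi1 x.2) (packet (- nu) p2 chi2 x.1)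
  (packet nu p1 chi1 x.1) (packet (- nu) p2 chi2 x.2).
by rewrite -2!packetN.
Qed.

(** On a box of side [nu / 2] in each of the six coordinates only one term of the determinant
    survives, and its first component is a product of six bumps, each at least [expR (- 4) ^+ 2]. *)
Lemma slater_ge (nu p1 p2 : R) (chi1 chi2 : 'cV[R]_(2 + 2)) : 0 < nu -> chi1 ord0 0 = 1 -> chi2 ord0 0 = 1 ->
  ((expR (- 4) ^+ 2) ^+ 6) ^+ 2 * (nu / 2) ^+ 6 <= L2norm (slater nu p1 p2 chi1 chi2) ^+ 2.
Proof.
move=> nu0 c1 c2; have nuN0 : nu != 0 by rewrite gt_eqF.
set b : R := expR (- 4) ^+ 2.
have b0 : 0 <= b by exact: sqr_ge0.
pose Q : set mR6 := cube (5 / 4 * nu) (7 / 4 * nu) `*` cube (- (7 / 4 * nu)) (- (5 / 4 * nu)).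
have mQ : measurable Q by apply: measurableX; exact: measurable_cube.
have le1 : 5 / 4 * nu <= 7 / 4 * nu by rewrite ler_pM2r//; lra.
have QE : leb6 Q = ((nu / 2) ^+ 6)%:E.
  rewrite leb6_cubes//; last by rewrite lerN2.
  by congr (_%:E); field.
have Qoo : (leb6 Q < +oo)%E by rewrite QE ltry.
have -> : (nu / 2) ^+ 6 = fine (leb6 Q) by rewrite QE.
apply: (L2norm_ge_support mQ Qoo (i := lshift _ (lshift _ (Mat_index 0 0)))).
- exact: (slater_HA2 _ _ _ _ nuN0).1.
- exact: exprn_ge0.
move=> [r1 r2] [/= [[q11 q12] q13] [[q21 q22] q23]].
rewrite /= !in_itv /= in q11 q12 q13 q21 q22 q23.
have E (u v : 'cV[C]_(2 + 2)) :
    kron4 u v (lshift _ (lshift _ (Mat_index 0 0))) 0 = u ord0 0 * v ord0 0.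
  have i0 : ord0 = lshift 2 (0 : 'I_2) by apply/val_inj.
  by rewrite /kron4 2!col_mxEu kron2E !mxE i0.
(* The first particle has a positive coordinate, where the packet of scale [- nu] vanishes. *)
have out : packet (- nu) p2 (- chi2) r1 = 0.
  apply: packet_outside; apply/negP => /and3P[/andP[h _] _ _].
  have : r1.1.1 / (- nu) <= 0.
    rewrite invrN mulrN oppr_le0 divr_ge0 ?(ltW nu0)//.
    by case/andP: q11 => q _; apply: le_trans q; rewrite mulr_ge0 ?(ltW nu0).
  by rewrite leNgt (lt_trans _ h).
have envE nu' p (chi : 'cV[R]_(2 + 2)) r : chi ord0 0 = 1 -> normc (packet nu' p chi r ord0 0) = envelope nu' r.
  move=> c; rewrite /packet mxE mxE c normcM normcM normc_phase !normc_real normr1 !mulr1.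
  by have /andP[e0 _] := envelope_bounds nu' r; rewrite ger0_norm.
have -> : slater nu p1 p2 chi1 chi2 (r1, r2) (lshift _ (lshift _ (Mat_index 0 0))) 0 =
    packet nu p1 chi1 r1 ord0 0 * packet (- nu) p2 chi2 r2 ord0 0.
  apply: etrans (etrans (entryD _ _ _) (congr2 +%R (E _ _) (E _ _))) _ => /=.
  by rewrite out [X in _ + X * _]mxE mul0r addr0.
rewrite normcM (envE _ _ _ _ c1) (envE _ _ _ _ c2).
have B t : 5 / 4 * nu <= t <= 7 / 4 * nu -> b <= scaled_bump nu t.
  by move=> /andP[t1 t2]; apply: bump_ge; rewrite ler_pdivlMr// t1 ler_pdivrMr.
have BN t : - (7 / 4 * nu) <= t <= - (5 / 4 * nu) -> b <= scaled_bump (- nu) t.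
  move=> /andP[t1 t2]; rewrite /scaled_bump invrN mulrN -mulNr; apply: B.
  by rewrite lerNr t2 lerNl.
have mul3 (x y z : R) : b <= x -> b <= y -> b <= z -> b ^+ 3 <= x * y * z.
  move=> bx bY bz; rewrite -[b ^+ 3]/(b * (b * b)) mulrA.
  by apply: ler_pM => //; [exact: mulr_ge0|exact: ler_pM].
rewrite (_ : b ^+ 6 = b ^+ 3 * b ^+ 3); last by rewrite -exprD.
by apply: ler_pM; rewrite ?exprn_ge0//; apply: mul3; [exact: B|exact: B|exact: B|exact: BN..].
Qed.

Lemma slater_residual m k k0 p1 p2 chi1 chi2 E1 E2 :
  p1%:C *: (dirac_alpha R ord0 *m map_mx (real_complex R) chi1) +
  m%:C *: (dirac_beta R *m map_mx (real_complex R) chi1) =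
    E1%:C *: map_mx (real_complex R) chi1 ->
  p2%:C *: (dirac_alpha R ord0 *m map_mx (real_complex R) chi2) +
  m%:C *: (dirac_beta R *m map_mx (real_complex R) chi2) =
    E2%:C *: map_mx (real_complex R) chi2 ->
  exists2 K, 0 <= K & forall nu, 0 < nu -> exists2 v,
    H_DC m k k0 (slater nu p1 p2 chi1 chi2, v) &
    forall x i, normc ((v - (E1 + E2)%:C *: slater nu p1 p2 chi1 chi2) x i 0)
      <= K / nu * \1_(support_cubes nu : set mR6) x.
Proof.
move=> eig1 eig2.
(* The domain of [H_DC] consists of plain sums of tensors, so the minus sign of the determinant is
   carried by the spinor. *)
have eig2N : p2%:C *: (dirac_alpha R ord0 *m map_mx (real_complex R) (- chi2)) +
    m%:C *: (dirac_beta R *m map_mx (real_complex R) (- chi2)) =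
      E2%:C *: map_mx (real_complex R) (- chi2).
  by rewrite map_mxN !mulmxN !scalerN -opprD eig2.
have [K1 K10 K1P] := pair_residual k k0 eig1 eig2.
have [K2 K20 K2P] := pair_residual k k0 eig2N eig1.
exists (K1 + K2); first exact: addr_ge0.
move=> nu nu0; have nuN0 : nu != 0 by rewrite gt_eqF.
set f := packet nu p1 chi1; set g := packet (- nu) p2 chi2.
set h := packet (- nu) p2 (- chi2).
set u := slater _ _ _ _ _.
pose A (j : 'I_2) := if val j == 0%N then f else h.
pose B (j : 'I_2) := if val j == 0%N then g else f.
have tf : test_function f by exact: test_function_packet.
have tg : test_function g by apply: test_function_packet; rewrite oppr_eq0.
have th : test_function h by apply: test_function_packet; rewrite oppr_eq0.
exists (fun x => \sum_(j < 2) (tensor (dirac_op m k (A j)) (B j) x +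
  tensor (A j) (dirac_op m k (B j)) x) + (k0 / euclid (x.1 - x.2))%:C *: u x).
  split; first exact: slater_HA2.
  exists 2%N, A, B; split => //=.
    by move=> j; rewrite /A /B; case: ifP.
  by apply/funext => x; rewrite big_ord_recl big_ord1.
move=> x i.
pose V := (k0 / euclid (x.1 - x.2))%:C.
have -> : ((fun x => \sum_(j < 2) (tensor (dirac_op m k (A j)) (B j) x +
    tensor (A j) (dirac_op m k (B j)) x) + (k0 / euclid (x.1 - x.2))%:C *: u x) -
    (E1 + E2)%:C *: u) x =
  (tensor (dirac_op m k f) g x + tensor f (dirac_op m k g) x + V *: tensor f g x -
    (E1 + E2)%:C *: tensor f g x) +
  (tensor (dirac_op m k h) f x + tensor h (dirac_op m k f) x + V *: tensor h f x -
    (E2 + E1)%:C *: tensor h f x).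
  rewrite -[LHS]/(\sum_(j < 2) (tensor (dirac_op m k (A j)) (B j) x +
    tensor (A j) (dirac_op m k (B j)) x) + V *: u x - (E1 + E2)%:C *: u x).
  rewrite big_ord_recl big_ord1 /= [E2 + E1]addrC.
  have arith (W : lmodType C) (c d : C) (s t y z : W) :
      s + t + c *: (y + z) - d *: (y + z) = (s + c *: y - d *: y) + (t + c *: z - d *: z).
    by rewrite !scalerDr opprD (addrACA s t) [LHS]addrACA.
  exact: arith.
rewrite mxE; apply: le_trans (le_normcD _ _) _; rewrite 2!mulrDl; apply: lerD.
  by have := K1P nu f g x i nuN0 erefl erefl; rewrite (gtr0_norm nu0).
have nuNN0 : - nu != 0 by rewrite oppr_eq0.
(* Used at scale [- nu], since the first factor of this tensor is the packet on the negative
   side. *)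
have := K2P (- nu) h f x i nuNN0 erefl; rewrite opprK => /(_ erefl).
by rewrite /support_cubes normrN (gtr0_norm nu0).
Qed.

(** A bound [M] on the inverse would compare a squared norm of order [nu ^+ 6] with a squared
    residual of order [nu ^+ 4], forcing [nu] to stay bounded. *)
Lemma real_in_spectrum (m k k0 : R) (T : set (F * F)) : linear_operator HA2 T ->
  H_DC m k k0 `<=` T -> forall l : R, spectrum HA2 T l%:C.
Proof.
move=> [TA _ _ _] extT l [_ [M MP]].
(* Then [E1 > |m|] and [E2 <= - |m| - 1], whatever the position of [l]. *)
pose E1 := `|l| + `|m| + 1; pose E2 := l - E1.
have m0 : 0 <= `|m| by []. have l0 : 0 <= `|l| by []. have ll := ler_norm l.
have mE1 : `|m| < `|E1| by rewrite (@ger0_norm _ E1) /E1; lra.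
have mE2 : `|m| < `|E2|.
  by rewrite (@ler0_norm _ E2) /E2 /E1; lra.
have [p1 [chi1 [eig1 c1]]] := plane_wave_spinor mE1.
have [p2 [chi2 [eig2 c2]]] := plane_wave_spinor mE2.
have [K K0 KP] := slater_residual k k0 eig1 eig2.
pose c : R := ((expR (- 4) ^+ 2) ^+ 6) ^+ 2.
have c_gt0 : 0 < c by rewrite !exprn_gt0// expR_gt0.
(* 16 counts components, [4 ^+ 6] comes from the support cubes of side [4 * nu], and 64 is 2 ^ 6
   from the box of side [nu / 2]. *)
pose D := M ^+ 2 * (16 * (K ^+ 2 * 4 ^+ 6)) * 64 / c.
have bound nu : 0 < nu -> nu ^+ 2 <= D.
  move=> nu0; have [v uv vP] := KP nu nu0.
  have [uA vA] := TA _ (extT _ uv).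
  have l12 : l%:C = (E1 + E2)%:C by rewrite /E2 addrCA subrr addr0.
  set u := slater _ _ _ _ _ in uv vP uA *; rewrite /= in uA vA.
  have mQ : measurable (support_cubes nu) by apply: measurableX; exact: measurable_cube.
  have le0 : - (2 * nu) <= 2 * nu by lra.
  have QE : leb6 (support_cubes nu) = ((4 * nu) ^+ 6)%:E.
    rewrite /support_cubes (gtr0_norm nu0) leb6_cubes//; congr (_%:E); ring.
  have Qoo : (leb6 (support_cubes nu) < +oo)%E by rewrite QE ltry.
  have r2 : square_integrable (v - (E1 + E2)%:C *: u).
    exact: (HA2B vA (HA2Z _ uA)).1.
  have Kn : 0 <= K / nu by rewrite divr_ge0// ltW.
  have up := L2norm_le_support mQ Qoo r2 Kn vP.
  have lo := slater_ge p1 p2 nu0 c1 c2; rewrite -/u -/c in lo.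
  have := MP _ _ (extT _ uv); rewrite l12 => uM.
  have uM2 : L2norm u ^+ 2 <= M ^+ 2 * L2norm (v - (E1 + E2)%:C *: u) ^+ 2.
    (* The sign of [M] is unknown; nonnegativity of the whole right-hand side is what permits
       squaring. *)
    have Mr0 := le_trans (L2norm_ge0 u) uM.
    by rewrite -exprMn ler_sqr ?nnegrE ?(L2norm_ge0 u).
  rewrite QE /= in up.
  have := le_trans lo (le_trans uM2 (ler_wpM2l (sqr_ge0 M) up)).
  have -> : c * (nu / 2) ^+ 6 = nu ^+ 2 * (nu ^+ 4 * c / 64) by field.
  have -> : M ^+ 2 * (16 * ((K / nu) ^+ 2 * (4 * nu) ^+ 6)) = D * (nu ^+ 4 * c / 64).
    by rewrite /D; field; rewrite !gt_eqF.
  by rewrite ler_pM2r// divr_gt0// mulr_gt0// exprn_gt0.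
have D0 : 0 <= D by apply: le_trans (sqr_ge0 1) (bound 1 ltr01).
(* The contradiction is [(D + 1) ^+ 2 > D]. *)
have := bound (D + 1) (ltr_wpDl D0 ltr01).
by rewrite leNgt => /negP[]; nra.
Qed.

End approximate_eigenvectors.

(** * The spectrum is the real line and has no isolated point *)

Theorem theorem4p2 (R : realType) (m k k0 : R)
    (hm : 0 <= m) (hk : `|k| < Num.sqrt 3 / 2) (hk0 : k0 != 0)
    (T : set (wavefun R * wavefun R))
    (saT : self_adjoint HA2 T)
    (extT : H_DC m k k0 `<=` T) :
  essential_spectrum HA2 T = range (fun x : R => x%:C).
Proof.
have real_spec (x : R) : spectrum HA2 T x%:C.
  by have [linT _ _] := saT; exact: real_in_spectrum linT extT x.
apply/seteqP; split=> [z [specz _]|_ [x _ <-]].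
  have z0 : complex.Im z = 0.
    apply/eqP; apply: contrapT => /negP zN0; apply: specz.
    exact: self_adjoint_nonreal_resolvent.
  by exists (complex.Re z) => //; apply/eqP; rewrite eq_complex /= z0 !eqxx.
split=> // -[[_ [e [e0 isolated]]] _ _].
(* A second point of the spectrum within distance [e] of [x]. *)
have /isolated : spectrum HA2 T (x + e / 2)%:C by exact: real_spec.
have e2 : 0 < e / 2 by rewrite divr_gt0.
rewrite -rmorphB /= addrAC subrr add0r normc_def /= expr0n addr0 sqrtr_sqr.
rewrite gtr0_norm// ltcR ltr_pdivrMr// ltr_pMr// ltr1n => /(_ isT) /complexI /eqP.
by rewrite -subr_eq0 addrAC subrr add0r gt_eqF.
Qed.
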